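(* Let $1 \le k \le m$. Let $A, C \subset [1\dots k]$ and $B, D \subset [1\dots m]$ be non-empty subsets with $|A|=|B|$ and $|C|=|D|$. The quantum minors $\Delta_{A,B}$ and $\Delta_{C,D}$ in $\mathbb{C}_q[Mat_{k\times m}]$ quasi-commute if and only if $S(A,B)$ and $S(C,D)$ are weakly separated subsets of $[1\dots m+k]$.
   Context: Notation: $[a\dots b]=\{a,a+1,\dots,b\}$; $X-Y$ denotes set difference. Quantum matrices: $\mathbb{C}_q[Mat_{k\times m}]$ ($k\le m$) is the unital $\mathbb{C}(q)$-algebra ($q$ an indeterminate) generated by $x_{i,j}$, $i\in[1\dots k]$, $j\in[1\dots m]$, subject to the relations: (i) $x_{s,t}x_{i,j}=q\,x_{i,j}x_{s,t}$ if either ($s>i$ and $t=j$) or ($s=i$ and $t>j$); (ii) $x_{s,t}x_{i,j}=x_{i,j}x_{s,t}$ if $s>i$ and $t<j$; (iii) $x_{s,t}x_{i,j}=x_{i,j}x_{s,t}+(q-q^{-1})x_{i,t}x_{s,j}$ if $s>i$ and $t>j$. Quantum minors: for non-empty $I=\{i_1<\dots<i_l\}\subset[1\dots k]$ and $J=\{j_1<\dots<j_l\}\subset[1\dots m]$ of the same size $l$, $\Delta_{I,J}=\sum_{\sigma\in S_l}(-q)^{-\ell(\sigma)}x_{i_1,j_{\sigma(1)}}\cdots x_{i_l,j_{\sigma(l)}}$, where $\ell(\sigma)$ is the length (number of inversions) of $\sigma$. Quasi-commutation: $\Delta_{A,B}$ and $\Delta_{C,D}$ quasi-commute if $\Delta_{C,D}\Delta_{A,B}=q^c\,\Delta_{A,B}\Delta_{C,D}$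 for some integer $c$. The sets $S(A,B)$: for $A\subset[1\dots k]$, $B\subset[1\dots m]$ with $|A|=|B|$, $S(A,B)=\{b+k: b\in B\}\sqcup\big([1\dots k]-w_0(A)\big)$, a $k$-subset of $[1\dots k+m]$, where $w_0(a)=k+1-a$ is the order-reversing permutation of $[1\dots k]$. Weak separation: for sets of integers write $X\prec Y$ if $x<y$ for all $x\in X$, $y\in Y$ (vacuously true if one is empty). Subsets $I,J\subset[1\dots n]$ are weakly separated if at least one of the following holds: (1) $|I|\ge|J|$ and $J-I$ can be partitioned as $J-I=J'\sqcup J''$ with $J'\prec I-J\prec J''$; (2) $|J|\ge|I|$ and $I-J$ can be partitioned as $I-J=I'\sqcup I''$ with $I'\prec J-I\prec I''$. (The parts are allowed to be empty.) *)

(* Defs.v *)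
From HB Require Import structures.
From mathcomp Require Import all_boot all_order all_algebra.
From mathcomp Require Import perm generic_quotient ring_quotient complex.
From mathcomp Require Import boolp reals.
From mathcomp Require Import monalg.

Set Implicit Arguments.
Unset Strict Implicit.
Unset Printing Implicit Defensive.

Import GRing.Theory.
Local Open Scope ring_scope.
Local Open Scope quotient_scope.

(* Indices are 0-based throughout: the integer i of [1..k] is the ordinal of
   value i - 1 in 'I_k, which only shifts all the comparisons. *)

Section QuantumMatrices.
Variables (F : fieldType) (q : F) (k m : nat).

(* The free unital F-algebra on letters x_(i,j), as the algebra of the free
   monoid on 'I_k * 'I_m. *)
Local Notation qmat_free := {malg F[{fmonom ('I_k * 'I_m)%type}]}.

Definition qmat_letter (i : 'I_k) (j : 'I_m) : qmat_free := mkmalgU (fmu (i, j)) 1.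
Local Notation X := qmat_letter.

Inductive qmat_rel : qmat_free -> qmat_free -> Prop :=
| QmatRel1 (s i : 'I_k) (t j : 'I_m) :
    ((i < s)%N /\ t = j) \/ (s = i /\ (j < t)%N) ->
    qmat_rel (X s t * X i j) (q *: (X i j * X s t))
| QmatRel2 (s i : 'I_k) (t j : 'I_m) :
    (i < s)%N -> (t < j)%N ->
    qmat_rel (X s t * X i j) (X i j * X s t)
| QmatRel3 (s i : 'I_k) (t j : 'I_m) :
    (i < s)%N -> (j < t)%N ->
    qmat_rel (X s t * X i j)
             (X i j * X s t + (q - q^-1) *: (X i t * X s j)).

(* The two-sided ideal generated by the relations; closure under opposites and
   scalars follows from closure under multiplication. *)
Inductive qmat_idealP : qmat_free -> Prop :=
| QmatIdealRel a b : qmat_rel a b -> qmat_idealP (a - b)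
| QmatIdeal0 : qmat_idealP 0
| QmatIdealD a b : qmat_idealP a -> qmat_idealP b -> qmat_idealP (a + b)
| QmatIdealM u a v : qmat_idealP a -> qmat_idealP (u * a * v).

Definition qmat_ideal : {pred qmat_free} := fun a => `[< qmat_idealP a >].

Lemma qmat_idealE a : (a \in qmat_ideal) = `[< qmat_idealP a >].
Proof. by []. Qed.

Lemma qmat_idealMl u a : a \in qmat_ideal -> u * a \in qmat_ideal.
Proof.
rewrite !qmat_idealE => /asboolP ha; apply/asboolP.
by rewrite -[u * a]mulr1; exact: QmatIdealM.
Qed.

Lemma qmat_idealMr u a : a \in qmat_ideal -> a * u \in qmat_ideal.
Proof.
rewrite !qmat_idealE => /asboolP ha; apply/asboolP.
by rewrite -[a]mul1r; exact: QmatIdealM.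
Qed.

Lemma qmat_ideal_zmod_closed : zmod_closed qmat_ideal.
Proof.
split=> [|a b]; first by apply/asboolP; exact: QmatIdeal0.
move=> /asboolP ha hb; apply/asboolP/QmatIdealD => //.
by apply/asboolP; rewrite -mulN1r; exact: qmat_idealMl.
Qed.
HB.instance Definition _ :=
  GRing.isZmodClosed.Build qmat_free qmat_ideal qmat_ideal_zmod_closed.

Lemma qmat_free_scaleE (c : F) (a : qmat_free) : c *: a = malgC c * a.
Proof. by rewrite mul_malgC. Qed.

Lemma qmat_idealZ (c : F) a : a \in qmat_ideal -> c *: a \in qmat_ideal.
Proof. by rewrite qmat_free_scaleE; exact: qmat_idealMl. Qed.

(* Properness: the constant coefficient is a ring morphism killing all the
   relations. *)
Lemma qmat_ideal_coef1 a : qmat_idealP a -> mcoeff mone a = 0.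
Proof.
have cM := (@mcoeff1g_is_multiplicative {fmonom ('I_k * 'I_m)%type} F).1.
have X0 i j : mcoeff mone (X i j) = 0.
  by rewrite mcoeffU1 -val_eqE /= fm1 fmU.
have XX0 i j y : mcoeff mone (X i j * y) = 0.
  by apply: etrans (cM _ _) _; rewrite X0 mul0r.
have Z0 c x : mcoeff mone x = 0 -> mcoeff mone (c *: x) = 0.
  by move=> x0; rewrite mcoeffZ x0 mulr0.
have B0 x y : mcoeff mone x = 0 -> mcoeff mone y = 0 -> mcoeff mone (x - y) = 0.
  by move=> x0 y0; rewrite mcoeffB x0 y0 subr0.
have D0 x y : mcoeff mone x = 0 -> mcoeff mone y = 0 -> mcoeff mone (x + y) = 0.
  by move=> x0 y0; rewrite mcoeffD x0 y0 addr0.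
elim=> {a} [a b | | a b _ IHa _ IHb | u a v _ IH].
- case=> [s i t j _ | s i t j _ _ | s i t j _ _];
    apply: B0; try exact: XX0.
  + by apply: Z0; exact: XX0.
  + by apply: D0; [exact: XX0 | apply: Z0; exact: XX0].
- exact: mcoeff0.
- exact: D0.
- by rewrite (cM (u * a) v) (cM u a) IH mulr0 mul0r.
Qed.

Definition qmat : Type := {ideal_quot qmat_ideal}.
HB.instance Definition _ := GRing.Zmodule.on qmat.
HB.instance Definition _ := EqQuotient.on qmat.

Local Notation pi := (\pi_qmat : qmat_free -> qmat).

Lemma eq_qmat (a b : qmat_free) : (pi a == pi b) = (a - b \in qmat_ideal).
Proof. by rewrite Quotient.idealrBE. Qed.

Definition qmat_one : qmat := lift_cst qmat 1.
Definition qmat_mul : qmat -> qmat -> qmat := lift_op2 qmat *%R.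
Definition qmat_scale (c : F) : qmat -> qmat := lift_op1 qmat ( *:%R c).

Lemma qmat_pi1 : pi 1 = qmat_one.
Proof. by rewrite /qmat_one; unlock. Qed.

Lemma qmat_piD (a b : qmat_free) : pi (a + b) = pi a + pi b.
Proof. by rewrite !piE. Qed.

Lemma qmat_piM (a b : qmat_free) : pi (a * b) = qmat_mul (pi a) (pi b).
Proof.
unlock qmat_mul.
apply/eqP; rewrite eq_qmat.
set a' := repr _; set b' := repr _.
have ha : a - a' \in qmat_ideal by rewrite -eq_qmat reprK.
have hb : b - b' \in qmat_ideal by rewrite -eq_qmat reprK.
have -> : a * b - a' * b' = (a - a') * b + a' * (b - b').
  by rewrite mulrBl mulrBr addrA subrK.
by apply: rpredD; [exact: qmat_idealMr | exact: qmat_idealMl].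
Qed.

Lemma qmat_piZ c (a : qmat_free) : pi (c *: a) = qmat_scale c (pi a).
Proof.
unlock qmat_scale.
apply/eqP; rewrite eq_qmat -scalerBr; apply: qmat_idealZ.
by rewrite -eq_qmat reprK.
Qed.

Lemma qmat_surj (x : qmat) : exists a, x = pi a.
Proof. by exists (repr x); rewrite reprK. Qed.

Lemma qmat_mulA : associative qmat_mul.
Proof.
by move=> x y z; case: (qmat_surj x) (qmat_surj y) (qmat_surj z) => [a ->] [b ->] [c ->];
   rewrite -!qmat_piM mulrA.
Qed.

Lemma qmat_mul1 : left_id qmat_one qmat_mul.
Proof. by move=> x; case: (qmat_surj x) => [a ->]; rewrite -qmat_pi1 -qmat_piM mul1r. Qed.

Lemma qmat_mulr1 : right_id qmat_one qmat_mul.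
Proof. by move=> x; case: (qmat_surj x) => [a ->]; rewrite -qmat_pi1 -qmat_piM mulr1. Qed.

Lemma qmat_mulDl : left_distributive qmat_mul +%R.
Proof.
move=> x y z; case: (qmat_surj x) (qmat_surj y) (qmat_surj z) => [a ->] [b ->] [c ->].
by rewrite -qmat_piD -!qmat_piM -qmat_piD mulrDl.
Qed.

Lemma qmat_mulDr : right_distributive qmat_mul +%R.
Proof.
move=> x y z; case: (qmat_surj x) (qmat_surj y) (qmat_surj z) => [a ->] [b ->] [c ->].
by rewrite -qmat_piD -!qmat_piM -qmat_piD mulrDr.
Qed.

Lemma qmat_one_neq0 : qmat_one != 0.
Proof.
have -> : (0 : qmat) = pi 0 by rewrite piE.
rewrite -qmat_pi1 eq_qmat subr0 qmat_idealE; apply/negP => /asboolP /qmat_ideal_coef1.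
by rewrite mcoeff1 eqxx => /eqP; rewrite oner_eq0.
Qed.

HB.instance Definition _ := GRing.Zmodule_isNzRing.Build qmat
  qmat_mulA qmat_mul1 qmat_mulr1 qmat_mulDl qmat_mulDr qmat_one_neq0.

Lemma qmat_scaleA (c d : F) (x : qmat) :
  qmat_scale c (qmat_scale d x) = qmat_scale (c * d) x.
Proof. by case: (qmat_surj x) => [a ->]; rewrite -!qmat_piZ scalerA. Qed.

Lemma qmat_scale1 : left_id 1 qmat_scale.
Proof.
by move=> x; case: (qmat_surj x) => [a ->]; rewrite -qmat_piZ scale1r.
Qed.

Lemma qmat_scaleDr : right_distributive qmat_scale +%R.
Proof.
move=> c x y; case: (qmat_surj x) (qmat_surj y) => [a ->] [b ->].
by rewrite -qmat_piD -!qmat_piZ -qmat_piD scalerDr.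
Qed.

Lemma qmat_scaleDl (x : qmat) : {morph qmat_scale^~ x : c d / c + d}.
Proof.
move=> c d /=; case: (qmat_surj x) => [a ->].
by rewrite -!qmat_piZ -qmat_piD scalerDl.
Qed.

Lemma qmat_scaleAl (c : F) (x y : qmat) :
  qmat_scale c (qmat_mul x y) = qmat_mul (qmat_scale c x) y.
Proof.
case: (qmat_surj x) (qmat_surj y) => [a ->] [b ->].
by rewrite -qmat_piM -!qmat_piZ -qmat_piM scalerAl.
Qed.

Lemma qmat_free_scaleAr (c : F) (a b : qmat_free) : c *: (a * b) = a * (c *: b).
Proof.
suff {b} comm: c *: a = a * malgC c.
  apply: etrans (scalerAl c a b) _; rewrite comm.
  by apply: etrans (esym (mulrA a (malgC c) b)) _; congr (a * _); exact: mul_malgC.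
rewrite malgM_def malgZ_def fgmulgU; apply: eq_bigr => w _.
by rewrite mulm1 mulrC.
Qed.

Lemma qmat_scaleAr (c : F) (x y : qmat) :
  qmat_scale c (qmat_mul x y) = qmat_mul x (qmat_scale c y).
Proof.
case: (qmat_surj x) (qmat_surj y) => [a ->] [b ->].
by rewrite -qmat_piM -!qmat_piZ -qmat_piM qmat_free_scaleAr.
Qed.

HB.instance Definition _ := GRing.Zmodule_isLmodule.Build F qmat
  qmat_scaleA qmat_scale1 qmat_scaleDr qmat_scaleDl.
HB.instance Definition _ := GRing.Lmodule_isLalgebra.Build F qmat qmat_scaleAl.
HB.instance Definition _ := GRing.Lalgebra_isAlgebra.Build F qmat qmat_scaleAr.

Definition qmat_x (i : 'I_k) (j : 'I_m) : qmat := pi (X i j).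

Definition perm_length (n : nat) (s : 'S_n) : nat :=
  #|[set p : 'I_n * 'I_n | (p.1 < p.2)%N && (s p.2 < s p.1)%N]|.

(* enum_val lists a set of ordinals increasingly, and the factors of the
   noncommutative product are taken from left to right. *)
Definition qminor (I : {set 'I_k}) (J : {set 'I_m}) (eqIJ : #|I| = #|J|) : qmat :=
  \sum_(s : 'S_#|I|) (- q) ^- perm_length s *:
    \prod_(a < #|I|) qmat_x (enum_val a) (enum_val (cast_ord eqIJ (s a))).

Definition quasi_commute (x y : qmat) : Prop :=
  exists c : int, y * x = q ^ c *: (x * y).

End QuantumMatrices.

Section RationalFunctions.
Variable R : realType.

(* C(q), where C = R[i] for R a model of the real numbers *)
Definition Cq : fieldType := {fraction {poly R[i]}}.
Definition Cq_q : Cq := tofrac 'X.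
End RationalFunctions.

(* lshift m i is the integer i of [1..k + m] and rshift k b is b + k; rev_ord
   is the order-reversing permutation w_0. *)
Definition minor_set (k m : nat) (A : {set 'I_k}) (B : {set 'I_m}) : {set 'I_(k + m)} :=
  [set rshift k b | b in B] :|:
  [set lshift m i | i in ~: [set rev_ord a | a in A]].

Definition set_prec (n : nat) (X Y : {set 'I_n}) : Prop :=
  forall x y, x \in X -> y \in Y -> (x < y)%N.

(* J - I = J1 |_| J2 with J1 < I - J < J2 elementwise; J1, J2 may be empty. *)
Definition surrounds (n : nat) (I J : {set 'I_n}) : Prop :=
  exists J1 J2 : {set 'I_n},
    [/\ J :\: I = J1 :|: J2, [disjoint J1 & J2],
        set_prec J1 (I :\: J) & set_prec (I :\: J) J2].

Definition weakly_separated (n : nat) (I J : {set 'I_n}) : Prop :=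
  ((#|J| <= #|I|)%N /\ surrounds I J) \/ ((#|I| <= #|J|)%N /\ surrounds J I).

(* Main.v *)
From HB Require Import structures.
Require Import Defs.
From mathcomp Require Import all_boot all_order all_algebra.
From mathcomp Require Import perm generic_quotient zify ring.
From mathcomp Require Import boolp reals monalg.

Set Implicit Arguments.
Unset Strict Implicit.
Unset Printing Implicit Defensive.

Import GRing.Theory.
Local Open Scope ring_scope.
Local Open Scope quotient_scope.

(** Write [Delta_(A, B)] for a quantum minor, and [qcomm e x y] for
    [y * x = q ^ e *: (x * y)].

    Moving indices.  Replacing row [p] by a combination of the rows [p] and
    [p + 1], with coefficients [d] and [e] which q-commute like entries of a
    triangular quantum matrix, is a homomorphism.  It sends [Delta_(A, B)] to a
    multiple of itself, plus [e] times the minor where [p] is replaced by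
    [p + 1] if [A] contains [p] and not [p + 1].  Comparing the coefficients of
    highest degree in [e] on both sides of a relation
    [Delta_(C, D) * Delta_(A, B) = q ^ c *: (Delta_(A, B) * Delta_(C, D))]
    shows that it persists for the moved pair ([qcomm_move]).  The exponent
    stays the same, except when one of [p], [p + 1] lies in [A] only and the
    other one in [C] only: then it changes by one.  One can also move [p + 1] to
    [p], and columns behave as rows ([qcomm_tr]).

    Words.  So only the word [r] of the pair [(A, C)] matters, which lists the
    rows belonging to exactly one of the two minors, in increasing order, with
    the letter [true] for [A] and [false] for [C]; similarly for the word [w] of
    the columns ([leqv_letters]).  Moreover two adjacent distinct letters can be
    cancelled, which changes the exponent by one ([wcomm_cancel]).  In
    [minor_set A B] and [minor_set C D] the rows are reversed and complemented,
    hence the elements in exactly one of these two sets form the word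
    [rev (map negb r) ++ w] ([letters_minor_set]).  As the two sets have the same
    size, they are weakly separated if and only if this word has the form
    [false ... false true ... true false ... false], or the form obtained by
    exchanging the letters ([surroundsP]).

    Necessity.  If [r = w], the character [x_ij |-> (i == j)] shows that the
    exponent is 0.  Any other pair is brought to this case by cancellations.
    See [true] as a step up and [false] as a step down.  Cancelling first the
    factors [true false] yields the exponent in terms of the height of a point
    on the path of the word, and exchanging the two minors gives a second
    expression in terms of another point.  Together they say that these two
    heights differ by half of the length of the word ([wcomm_height]), so that
    all the letters of one kind stand between the two points.

    Sufficiency.  If [i] is at most and [j] at least all the indices in [C] and
    [D] respectively, then [x_ij] commutes up to a power of [q] with every term
    of [Delta_(C, D)] ([corner_top]); the same holds in the opposite corner.  A
    row [i] of [C] can be moved to the top or to the bottom of [C], and a column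
    of [D] to either side of [D], so what matters is only whether an index
    outside [C] or [D] is smaller or larger than all of it.  The exponent is then
    the sum of a function of [i] and of a function of [j] ([qcomm_entry]), hence
    the same for all the terms of a minor made of such entries
    ([qcomm_entries]).  For a weakly separated pair, the common rows and columns
    can be moved so that all the entries of one minor are of this kind with
    respect to the other one ([qcomm_words]). *)

(** * Homomorphisms out of quantum matrices *)

Section QuantumFamilies.
Variables (F : fieldType) (q : F) (S : algType F) (m : nat).
Implicit Types X Y : 'I_m -> S.

(** The defining relations are grouped by rows because [qrel] is bilinear in
    [(X, Y)], which makes them easy to check for combinations of rows. *)
Definition qrow X := forall t j : 'I_m, (j < t)%N -> X t * X j = q *: (X j * X t).

Definition qrel X Y := [/\ forall t, Y t * X t = q *: (X t * Y t),
  forall t j : 'I_m, (t < j)%N -> Y t * X j = X j * Y t &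
  forall t j : 'I_m, (j < t)%N ->
    Y t * X j = X j * Y t + (q - q^-1) *: (X t * Y j)].

Definition qfamily k (y : 'I_k -> 'I_m -> S) :=
  (forall i, qrow (y i)) /\ (forall i s : 'I_k, (i < s)%N -> qrel (y i) (y s)).
End QuantumFamilies.

Section UniversalProperty.
Variables (F : fieldType) (q : F) (k m : nat).
Local Notation qmat_free := {malg F[{fmonom ('I_k * 'I_m)%type}]}.
Local Notation Q := (qmat q k m).
Local Notation pi := (\pi_Q : qmat_free -> Q).
Local Notation x := (@qmat_x F q k m).

Lemma pi_mul a b : pi (a * b) = pi a * pi b.
Proof. exact: qmat_piM. Qed.

Lemma pi_scale c a : pi (c *: a) = c *: pi a.
Proof. exact: qmat_piZ. Qed.

Lemma qmat_x_family : qfamily q x.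
Proof.
have R a b : qmat_rel q a b -> pi a = pi b.
  by move=> ab; apply/eqP; rewrite eq_qmat qmat_idealE; apply/asboolP/QmatIdealRel.
have Z c a : pi (c *: a) = c *: pi a by exact: pi_scale.
split=> [i t j jt|i s lt_is].
  by rewrite /qmat_x -!pi_mul -Z; apply/R/QmatRel1; right.
split=> [t|t j lt|t j lt]; rewrite /qmat_x -!pi_mul.
- by rewrite -Z; apply/R/QmatRel1; left.
- exact/R/QmatRel2.
- by rewrite -Z -qmat_piD; apply/R/QmatRel3.
Qed.

Lemma qmat_x_row (s : 'I_k) (j t : 'I_m) : (j < t)%N ->
  x s t * x s j = q *: (x s j * x s t).
Proof. exact: qmat_x_family.1. Qed.

Lemma qmat_x_col (i s : 'I_k) (t : 'I_m) : (i < s)%N ->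
  x s t * x i t = q *: (x i t * x s t).
Proof. by move=> lt; have [r _ _] := qmat_x_family.2 _ _ lt; exact: r. Qed.

Lemma qmat_x_comm (i s : 'I_k) (t j : 'I_m) : (i < s)%N -> (t < j)%N ->
  x s t * x i j = x i j * x s t.
Proof. by move=> lt; have [_ r _] := qmat_x_family.2 _ _ lt; exact: r. Qed.

Variables (S : algType F) (y : 'I_k -> 'I_m -> S).

Definition word_eval (w : {fmonom ('I_k * 'I_m)%type}) : S :=
  \prod_(p <- w : seq _) y p.1 p.2.

Fact word_eval_mmorphism : mmorphism word_eval.
Proof.
split=> [v w|]; rewrite /word_eval; first by rewrite fmM big_cat.
by rewrite fm1 big_nil.
Qed.
HB.instance Definition _ := isMultiplicative.Build _ _ word_eval word_eval_mmorphism.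

Definition free_eval : qmat_free -> S := mmap (in_alg S) word_eval.

Lemma free_evalM : {morph free_eval : a b / a * b}.
Proof.
apply: (commr_mmap_is_multiplicative _).1 => g v w.
by rewrite /GRing.comm /= mulr_algl mulr_algr.
Qed.

Lemma free_evalD : {morph free_eval : a b / a + b}.
Proof. exact: mmapD. Qed.

Lemma free_evalB : {morph free_eval : a b / a - b}.
Proof. exact: mmapB. Qed.

Lemma free_evalZ c a : free_eval (c *: a) = c *: free_eval a.
Proof. by rewrite /free_eval mmapZ /= mulr_algl. Qed.

Lemma free_eval1 : free_eval 1 = 1.
Proof. exact: mmap1. Qed.

Lemma free_eval_letter i j : free_eval (qmat_letter F i j) = y i j.
Proof.
by rewrite /free_eval mmapU /= scale1r mul1r /word_eval fmU big_seq1.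
Qed.

Hypothesis yP : qfamily q y.

Lemma free_eval_ideal a : qmat_idealP q a -> free_eval a = 0.
Proof.
elim=> {a} [a b ab | | a b _ IHa _ IHb | u a v _ IHa].
- have evXX s t i j :
      free_eval (qmat_letter F s t * qmat_letter F i j) = y s t * y i j.
    by apply: etrans (free_evalM _ _) _; congr (_ * _); exact: free_eval_letter.
  apply: etrans (free_evalB _ _) _; apply/eqP; rewrite subr_eq0; apply/eqP.
  case: ab => [s i t j h|s i t j lt_is lt_tj|s i t j lt_is lt_jt].
  + apply: etrans (evXX _ _ _ _) _; apply: esym; apply: etrans (free_evalZ _ _) _.
    rewrite evXX; case: h => [[lt_is ->]|[-> lt_jt]]; last by rewrite (yP.1 i t j).
    by case: (yP.2 _ _ lt_is) => ->.
  + apply: etrans (evXX _ _ _ _) _; apply: esym; apply: etrans (evXX _ _ _ _) _.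
    by case: (yP.2 _ _ lt_is) => _ ->.
  + have [_ _ y3] := yP.2 _ _ lt_is.
    apply: etrans (evXX _ _ _ _) _; apply: etrans (y3 _ _ lt_jt) _; apply: esym.
    apply: etrans (free_evalD _ _) _; congr (_ + _); first exact: evXX.
    by apply: etrans (free_evalZ _ _) _; congr (_ *: _); exact: evXX.
- exact: mmap0.
- by rewrite free_evalD IHa IHb addr0.
- by rewrite !free_evalM IHa mulr0 mul0r.
Qed.

(** A homomorphism out of quantum matrices is given by the images of the
    generators. *)
Theorem qmat_universal :
  exists f : {lrmorphism Q -> S}, forall i j, f (x i j) = y i j.
Proof.
pose f (a : Q) := free_eval (repr a).
have fpi a : f (pi a) = free_eval a.
  apply/eqP; rewrite -subr_eq0 -free_evalB; apply/eqP/free_eval_ideal/asboolP.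
  by rewrite -qmat_idealE -eq_qmat reprK.
have fB : zmod_morphism f.
  move=> a b; case: (qmat_surj a) (qmat_surj b) => [a' ->] [b' ->].
  have -> : pi a' - pi b' = pi (a' - b') by rewrite !piE.
  by rewrite !fpi free_evalB.
have fM : monoid_morphism f.
  split=> [|a b]; first by rewrite -[1]qmat_pi1 fpi free_eval1.
  case: (qmat_surj a) (qmat_surj b) => [a' ->] [b' ->].
  by rewrite -pi_mul !fpi free_evalM.
have fZ : scalable f.
  move=> c a; case: (qmat_surj a) => [a' ->].
  by rewrite -pi_scale !fpi free_evalZ.
pose fa := GRing.isZmodMorphism.Build _ _ f fB.
pose fm := GRing.isMonoidMorphism.Build _ _ f fM.
pose fz := GRing.isScalable.Build _ _ _ _ f fZ.
pose fl : {lrmorphism Q -> S} := HB.pack f fa fm fz.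
by exists fl => i j; rewrite [fl _]fpi free_eval_letter.
Qed.
End UniversalProperty.

(** * Commutation up to a power of q *)

Section QCommutation.
Variables (F : fieldType) (q : F) (S : algType F).
Implicit Types (x y z : S) (e f : int).

Definition qcomm e x y := y * x = q ^ e *: (x * y).

Hypothesis q0 : q != 0.

Lemma qcomm_sym e x y : qcomm e x y -> qcomm (- e) y x.
Proof.
by rewrite /qcomm => ->; rewrite scalerA -expfzDr // addNr expr0z scale1r.
Qed.

Lemma qcommMl e f x y z : qcomm e x z -> qcomm f y z -> qcomm (e + f) (x * y) z.
Proof.
rewrite /qcomm => xz yz.
rewrite mulrA xz -scalerAl -[x * z * y]mulrA yz -scalerAr scalerA -expfzDr //.
by rewrite mulrA.
Qed.

Lemma qcomm1l z : qcomm 0 1 z.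
Proof. by rewrite /qcomm mulr1 mul1r expr0z scale1r. Qed.

Lemma qcommZl e c x z : qcomm e x z -> qcomm e (c *: x) z.
Proof. by rewrite /qcomm -scalerAr -scalerAl => ->; rewrite !scalerA mulrC. Qed.

Lemma qcomm_suml (I : Type) (r : seq I) e (f : I -> S) z :
  (forall i, qcomm e (f i) z) -> qcomm e (\sum_(i <- r) f i) z.
Proof.
move=> fz; rewrite /qcomm mulr_sumr mulr_suml scaler_sumr.
by apply: eq_bigr => i _; exact: fz.
Qed.

Lemma qcomm_prodl (I : Type) (r : seq I) (e : I -> int) (f : I -> S) z :
  (forall i, qcomm (e i) (f i) z) -> qcomm (\sum_(i <- r) e i) (\prod_(i <- r) f i) z.
Proof.
move=> fz; elim: r => [|i r IHr]; first by rewrite !big_nil; exact: qcomm1l.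
by rewrite !big_cons; exact: qcommMl.
Qed.
End QCommutation.

(** * Quantum determinants *)

Lemma enum_ord_split n (a b : 'I_n) : val b = (val a).+1 ->
  exists s1 s2, [/\ index_enum 'I_n = s1 ++ a :: b :: s2,
    a \notin s1 ++ s2 & b \notin s1 ++ s2].
Proof.
move=> ab; have ub := index_enum_uniq 'I_n.
have sv : map val (index_enum 'I_n) = iota 0 n.
  by rewrite -val_enum_ord enumT.
have va : nth 0%N (map val (index_enum 'I_n)) a = a by rewrite sv nth_iota ?ltn_ord.
have sz : size (index_enum 'I_n) = n by rewrite -(size_map val) sv size_iota.
have na x : nth a (index_enum 'I_n) (val x) = x.
  apply: val_inj; rewrite -(nth_map _ 0%N) ?sz ?ltn_ord // sv.
  by rewrite nth_iota ?ltn_ord.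
exists (take a (index_enum 'I_n)), (drop b.+1 (index_enum 'I_n)).
have eq : index_enum 'I_n =
    take a (index_enum 'I_n) ++ a :: b :: drop b.+1 (index_enum 'I_n).
  rewrite -{1}[index_enum 'I_n](cat_take_drop (val a)); congr (_ ++ _).
  rewrite (drop_nth a) ?sz ?ltn_ord // na -ab; congr (_ :: _).
  by rewrite (drop_nth a) ?sz ?ltn_ord // na.
split=> //; move: ub; rewrite {1}eq cat_uniq /= !inE !negb_or !mem_cat !negb_or.
  by case/and4P=> _ /and3P[-> _ _] /andP[_ ->].
by case/and4P=> _ /and3P[_ -> _] _ /andP[-> _].
Qed.

(** Exchanging the values at two adjacent positions adds the pair of these
    positions to the inversions, and permutes the other inversions. *)
Lemma perm_length_tperm n (a b : 'I_n) (s : 'S_n) : val b = (val a).+1 ->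
  (s a < s b)%N -> perm_length (tperm a b * s)%g = (perm_length s).+1.
Proof.
move=> ab sab; rewrite /perm_length.
pose g (p : 'I_n * 'I_n) := (tperm a b p.1, tperm a b p.2).
have gK : involutive g by case=> i j; rewrite /g /= !tpermK.
pose f (x : 'I_n) := nat_of_ord (s x).
pose Is := [set p : 'I_n * 'I_n | (p.1 < p.2)%N && (f p.2 < f p.1)%N].
have -> : [set p : 'I_n * 'I_n | (p.1 < p.2)%N &&
    ((tperm a b * s)%g p.2 < (tperm a b * s)%g p.1)%N] = (a, b) |: g @: Is.
  apply/setP=> -[i j]; rewrite !inE -[(i, j) in X in _ || X]gK.
  rewrite (mem_imset _ _ (inv_inj gK)) inE /= !permM xpair_eqE.
  rewrite -![nat_of_ord (s _)]/(f _).
  have eqn (x y : 'I_n) : (x == y) = (nat_of_ord x == nat_of_ord y) by [].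
  have neq (x y : 'I_n) : x <> y -> nat_of_ord x <> nat_of_ord y.
    by move=> xy /val_inj.
  move: sab; rewrite !eqn -![nat_of_ord (s _)]/(f _); move: ab => /= ab sab.
  case: (tpermP a b i) => [->|->|/neq ia /neq ib];
    case: (tpermP a b j) => [->|->|/neq ja /neq jb]; lia.
rewrite cardsU1 card_imset; last exact: inv_inj.
rewrite -[(a, b)]gK (mem_imset _ _ (inv_inj gK)) inE /= tpermL tpermR.
by rewrite ab ltnNge leqnSn.
Qed.

Section QuantumDeterminant.
Variables (F : fieldType) (q : F) (S : algType F).

(** The factors are ordered by rows.  The entries need not satisfy the relations
    of quantum matrices: this is what makes expansions along a row possible. *)
Definition qdet l (y : 'I_l -> 'I_l -> S) : S :=
  \sum_(s : 'S_l) (- q) ^- perm_length s *: \prod_(a < l) y a (s a).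

Lemma eq_qdet l (y z : 'I_l -> 'I_l -> S) :
  (forall a b, y a b = z a b) -> qdet y = qdet z.
Proof. by move=> yz; apply: eq_bigr => s _; congr (_ *: _); apply: eq_bigr. Qed.

Lemma qdetD l (a0 : 'I_l) (y u v : 'I_l -> 'I_l -> S) :
  (forall j, y a0 j = u a0 j + v a0 j) ->
  (forall a j, a != a0 -> y a j = u a j) ->
  (forall a j, a != a0 -> y a j = v a j) ->
  qdet y = qdet u + qdet v.
Proof.
move=> y0 yu yv; rewrite /qdet -big_split; apply: eq_bigr => s _ /=.
rewrite -scalerDr; congr (_ *: _).
case: (path.splitPr (mem_index_enum a0)) (index_enum_uniq 'I_l) => r1 r2.
rewrite cat_uniq /= !negb_or => /and4P[_ /andP[n1 _] n2 _].
have E w r : (forall a j, a != a0 -> y a j = w a j) -> a0 \notin r ->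
    \prod_(a <- r) y a (s a) = \prod_(a <- r) w a (s a).
  move=> yw nr; rewrite !big_seq; apply: eq_bigr => a ar; apply: yw.
  by apply: contraNneq nr => <-.
rewrite !big_cat !big_cons /= y0 mulrDl mulrDr.
by rewrite {1}(E u r1) // {1}(E u r2) // (E v r1) // (E v r2).
Qed.

(** Composing with the transposition of the positions of the two equal rows
    pairs off the terms: the length grows by one, and reordering the two
    entries costs q. *)
Lemma qdet_eq_rows l (a b : 'I_l) (y : 'I_l -> 'I_l -> S) : q != 0 ->
  val b = (val a).+1 -> (forall j, y b j = y a j) -> qrow q (y a) -> qdet y = 0.
Proof.
move=> q0 ab yab row_y; have [r1 [r2 [eq_r nar nbr]]] := enum_ord_split ab.
have aNb : a != b by apply/eqP => e; move: ab; rewrite e => /eqP; rewrite ltn_eqF.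
rewrite /qdet (bigID (fun s : 'S_l => (s a < s b)%N)) /=.
rewrite [X in _ + X](reindex_inj (mulgI (tperm a b))) /=.
rewrite [X in _ + X](eq_bigl (fun s : 'S_l => (s a < s b)%N)) => [|s]; last first.
  rewrite !permM tpermL tpermR -leqNgt leq_eqVlt [(s a < _)%N]lock.
  by rewrite val_eqE (inj_eq perm_inj) (negbTE aNb) -lock.
rewrite -big_split big1 //= => s sab.
rewrite (perm_length_tperm ab sab) eq_r !big_cat !big_cons /= !permM tpermL tpermR.
have E r : {subset r <= r1 ++ r2} ->
    \prod_(i <- r) y i ((tperm a b * s)%g i) = \prod_(i <- r) y i (s i).
  move=> sr; rewrite !big_seq; apply: eq_bigr => i ir; rewrite permM tpermD //.
    by apply: contraNneq nar => ->; exact: sr.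
  by apply: contraNneq nbr => ->; exact: sr.
rewrite !E => [|i ir|i ir]; try by rewrite mem_cat ir ?orbT.
rewrite !yab [y a (s b) * (y a (s a) * _)]mulrA row_y // -!scalerAl -!scalerAr !scalerA.
rewrite -mulrA -scalerDl exprS invfM mulrAC.
have -> : (- q)^-1 * q = -1 by rewrite invrN mulNr mulVf.
by rewrite mulN1r subrr scale0r.
Qed.

(** All terms of the expansion acquire the same exponent, as each of them
    involves every row and every column once. *)
Lemma qdet_qcomm l (al be : 'I_l -> int) (y : 'I_l -> 'I_l -> S) z : q != 0 ->
  (forall a b, qcomm q (al a + be b) (y a b) z) ->
  qcomm q (\sum_a al a + \sum_b be b) (qdet y) z.
Proof.
move=> q0 yz; apply: qcomm_suml => s; apply: qcommZl.
have -> : \sum_a al a + \sum_b be b = \sum_a (al a + be (s a)).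
  by rewrite big_split /= [X in _ + X](reindex_inj (@perm_inj _ s)).
by apply: qcomm_prodl => // a.
Qed.
End QuantumDeterminant.

(** * Quantum minors *)

Definition incr l n (f : 'I_l -> 'I_n) := forall a b : 'I_l, (a < b)%N -> (f a < f b)%N.

Lemma incr_inj l n (f : 'I_l -> 'I_n) : incr f -> injective f.
Proof.
move=> fi a b eq_ab; apply/val_inj; case: (ltngtP a b) => // /fi;
  by rewrite eq_ab ltnn.
Qed.

Lemma incr_card l n (f : 'I_l -> 'I_n) : incr f -> #|f @: [set: 'I_l]| = l.
Proof. by move=> fi; rewrite card_imset ?cardsT ?card_ord //; exact: incr_inj. Qed.

(** Increasing enumerations of a set are unique, which makes any of them as good
    as [enum_val]. *)
Lemma incr_unique l n (f g : 'I_l -> 'I_n) :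
  incr f -> incr g -> f @: [set: 'I_l] = g @: [set: 'I_l] -> f =1 g.
Proof.
have sv h : incr h -> sorted ltn [seq val (h a) | a <- enum 'I_l].
  move=> hi; have : sorted ltn (map val (enum 'I_l)) by rewrite val_enum_ord iota_ltn_sorted.
  by rewrite !sorted_map; apply: sub_sorted => a b; exact: hi.
move=> fi gi fg a.
suff eq_s : [seq val (f a) | a <- enum 'I_l] = [seq val (g a) | a <- enum 'I_l].
  apply/val_inj; have := congr1 (nth 0%N ^~ a) eq_s.
  by rewrite /= !(nth_map a) -?enumT ?size_enum_ord ?ltn_ord ?nth_ord_enum.
apply: (irr_sorted_eq ltn_trans ltnn) => [||i]; rewrite ?sv //.
have im h : (i \in [seq val (h a) | a <- enum 'I_l]) = (i \in map val (enum (h @: [set: 'I_l]))).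
  rewrite map_comp; apply/mapP/mapP => -[x xs ->]; exists x => //.
    by case/mapP: xs => y _ ->; rewrite mem_enum imset_f.
  by move: xs; rewrite mem_enum => /imsetP[y _ ->]; rewrite map_f // mem_enum.
by rewrite !im fg.
Qed.

Lemma enum_val_incr n (A : {set 'I_n}) : incr (@enum_val _ (mem A)).
Proof.
move=> a b ab; have sA : sorted ltn (map val (enum A)).
  rewrite sorted_map /enum_mem; apply: sorted_filter; first by move=> x y z; exact: ltn_trans.
  by rewrite -sorted_map -enumT val_enum_ord iota_ltn_sorted.
have := sorted_ltn_nth ltn_trans 0%N sA; move/(_ a b).
rewrite !inE size_map -cardE !ltn_ord => /(_ isT isT ab).
have x0 := enum_val a.
by rewrite !(nth_map x0) -?cardE ?ltn_ord // !(enum_val_nth x0).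
Qed.

Section Minors.
Variables (F : fieldType) (q : F).

(** [qminor] depends on a proof that the index sets have equal sizes; making it
    total allows rewriting the index sets. *)
Definition qm k m (A : {set 'I_k}) (B : {set 'I_m}) : qmat q k m :=
  if #|A| =P #|B| is ReflectT h then qminor q h else 0.

Lemma qmE k m (A : {set 'I_k}) (B : {set 'I_m}) (h : #|A| = #|B|) :
  qm A B = qminor q h.
Proof. by rewrite /qm; case: eqP => // h'; rewrite (eq_irrelevance h h'). Qed.

Lemma qm_neq k m (A : {set 'I_k}) (B : {set 'I_m}) : #|A| <> #|B| -> qm A B = 0.
Proof. by rewrite /qm; case: eqP. Qed.

Lemma qm_incr k m l (r : 'I_l -> 'I_k) (c : 'I_l -> 'I_m) : incr r -> incr c ->
  qm (r @: [set: 'I_l]) (c @: [set: 'I_l]) =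
  qdet q (fun a b => qmat_x q (r a) (c b)).
Proof.
move=> ri ci; have h := etrans (incr_card ri) (esym (incr_card ci)).
rewrite (qmE h) /qminor.
suff gen l' (e : #|r @: [set: 'I_l]| = l') (e' : #|c @: [set: 'I_l]| = l')
    (r' : 'I_l' -> 'I_k) (c' : 'I_l' -> 'I_m) : incr r' -> incr c' ->
    r' @: [set: 'I_l'] = r @: [set: 'I_l] -> c' @: [set: 'I_l'] = c @: [set: 'I_l] ->
    qminor q h = qdet q (fun a b => qmat_x q (r' a) (c' b)).
  exact: (gen l (incr_card ri) (incr_card ci)).
case: l' / e e' r' c' => e' r' c' r'i c'i er ec.
apply: eq_bigr => s _; congr (_ *: _); apply: eq_bigr => a _; congr qmat_x.
  apply: (incr_unique (@enum_val_incr _ _) r'i); rewrite er.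
  apply/setP=> x; apply/imsetP/idP => [[y _ ->]|xr]; first exact: enum_valP.
  by exists (enum_rank_in xr x); rewrite ?enum_rankK_in.
have ci' : incr (fun b => @enum_val _ (mem (c @: [set: 'I_l])) (cast_ord h b)).
  by move=> a' b' ab; apply: enum_val_incr.
apply: (incr_unique ci' c'i); rewrite ec.
apply/setP=> x; apply/imsetP/idP => [[y _ ->]|xr]; first exact: enum_valP.
exists (cast_ord (esym h) (enum_rank_in xr x)) => //.
by rewrite cast_ordKV enum_rankK_in.
Qed.

Lemma incr_enum n l (A : {set 'I_n}) : #|A| = l ->
  exists2 r : 'I_l -> 'I_n, incr r & A = r @: [set: 'I_l].
Proof.
case: l /; exists enum_val; first exact: enum_val_incr.
apply/setP=> x; apply/idP/imsetP => [xr|[y _ ->]]; last exact: enum_valP.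
by exists (enum_rank_in xr x); rewrite ?enum_rankK_in.
Qed.

Lemma incr_enum2 k m (A : {set 'I_k}) (B : {set 'I_m}) : #|A| = #|B| ->
  exists l (r : 'I_l -> 'I_k) (c : 'I_l -> 'I_m),
    [/\ incr r, incr c, A = r @: [set: 'I_l] & B = c @: [set: 'I_l]].
Proof.
move=> AB; have [r ri eA] := incr_enum AB.
by have [c ci eB] := incr_enum (erefl #|B|); exists #|B|, r, c.
Qed.

Lemma qm1 k m (i : 'I_k) (j : 'I_m) : qm [set i] [set j] = qmat_x q i j.
Proof.
have im n (u : 'I_n) : [set u] = (fun=> u) @: [set: 'I_1].
  by apply/setP=> x; rewrite inE; apply/eqP/imsetP => [->|[]//]; exists ord0.
have ic n (u : 'I_n) : incr (fun _ : 'I_1 => u) by move=> a b; rewrite !ord1.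
rewrite !im qm_incr // /qdet (big_pred1 (1%g : 'S_1)) => [|s]; last first.
  by apply/esym/eqP/permP => a; rewrite !ord1.
rewrite big_ord1 [perm_length _](_ : _ = 0%N) ?expr0 ?invr1 ?scale1r //.
by apply: eq_card0 => -[a b]; rewrite !inE !ord1.
Qed.
End Minors.

(** * Transposition *)

(** Reordering a product into the order given by another key only needs the
    pairs of factors which change order to commute. *)
Lemma prod_reorder (T : eqType) (R : nzRingType) (f : T -> R) (u v : T -> nat)
    (s t : seq T) : perm_eq s t ->
  pairwise (relpre u ltn) s -> pairwise (relpre v ltn) t ->
  (forall x y, (u x < u y)%N -> (v y < v x)%N -> f x * f y = f y * f x) ->
  \prod_(x <- s) f x = \prod_(x <- t) f x.
Proof.
move=> st us vt cf; elim: t s st us vt => [|x t IHt] s st us vt.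
  by rewrite (perm_nilP st).
have xs : x \in s by rewrite (perm_mem st) mem_head.
case: (path.splitPr xs) st us => s1 s2 st us.
have st' : perm_eq (s1 ++ s2) t.
  by move: st; rewrite -cat1s perm_catCA perm_cons.
move: us vt; rewrite pairwise_cat /= allrel_consr.
case/and4P=> /andP[s1x s12] us1 xs2 us2 /andP[xt vt].
rewrite big_cons -(IHt (s1 ++ s2)) ?pairwise_cat ?s12 ?us1 ?us2 //.
rewrite !big_cat big_cons /= !mulrA; congr (_ * _).
have sub : {subset s1 <= t} by move=> y ys; rewrite -(perm_mem st') mem_cat ys.
elim: s1 s1x sub {xs st us1 s12 IHt st'} => [|y s1 IHs] /=.
  by rewrite !big_nil mulr1 mul1r.
case/andP=> yx s1x sub; rewrite !big_cons -mulrA IHs // => [|z zs]; last first.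
  by apply: sub; rewrite inE zs orbT.
rewrite !mulrA; congr (_ * _); apply: cf => //.
by apply: (allP xt); apply: sub; rewrite mem_head.
Qed.

Lemma perm_length_inv n (s : 'S_n) : perm_length s^-1%g = perm_length s.
Proof.
pose g (p : 'I_n * 'I_n) := (s p.2, s p.1).
have gi : injective g by move=> [a b] [c d] [/perm_inj -> /perm_inj ->].
rewrite /perm_length -[RHS](card_imset _ gi); congr #|pred_of_set _|.
apply/setP=> -[i j]; apply/idP/imsetP => [|[[a b]]].
  rewrite inE /= => /andP[ij sij]; exists ((s^-1)%g j, (s^-1)%g i).
    by rewrite inE /= !permKV sij.
  by rewrite /g /= !permKV.
by rewrite inE /= => /andP[ab sab] [-> ->]; rewrite inE /= !permK ab sab.
Qed.

(** Ordering by rows or by columns gives the same product: the order of two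
    factors changes only if they form an inversion, and then they commute. *)
Lemma qdet_tr (F : fieldType) (q : F) (S : algType F) l (y : 'I_l -> 'I_l -> S) :
  (forall a b i j : 'I_l, (a < b)%N -> (i < j)%N -> y a j * y b i = y b i * y a j) ->
  qdet q y = qdet q (fun a b => y b a).
Proof.
have invI : injective (fun s : 'S_l => s^-1%g) by exact: invg_inj.
move=> yC; rewrite [RHS](reindex_inj invI); apply: eq_bigr => s _ /=.
rewrite perm_length_inv; congr (_ *: _).
rewrite [RHS](eq_bigr (fun b => y (s^-1%g b) (s (s^-1%g b)))) => [|b _]; last first.
  by rewrite permKV.
rewrite -(big_map (s^-1%g) xpredT (fun a => y a (s a))).
have pw : pairwise (relpre val ltn) (index_enum 'I_l).
  rewrite -sorted_pairwise; last by move=> ? ? ?; exact: ltn_trans.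
  by rewrite -sorted_map -[index_enum _]enumT val_enum_ord iota_ltn_sorted.
apply: (@prod_reorder _ _ _ val (fun a => val (s a))) => //.
- apply: uniq_perm; rewrite ?map_inj_uniq ?index_enum_uniq //; first exact: perm_inj.
  move=> a; rewrite mem_index_enum; apply/esym/mapP.
  by exists (s a); rewrite ?permK ?mem_index_enum.
- rewrite pairwise_map; apply: sub_pairwise pw => a b /=.
  by rewrite !permKV.
- by move=> a b ab sab; apply: yC.
Qed.

Section Transposition.
Variables (F : fieldType) (q : F).

Lemma qdet_morph (S S' : algType F) (f : {lrmorphism S -> S'}) l (y : 'I_l -> 'I_l -> S) :
  f (qdet q y) = qdet q (fun a b => f (y a b)).
Proof.
rewrite /qdet rmorph_sum; apply: eq_bigr => s _ /=.
by rewrite linearZ /= rmorph_prod.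
Qed.

Lemma qcomm_morph (S S' : algType F) (f : {lrmorphism S -> S'}) e x y :
  qcomm q e x y -> qcomm q e (f x) (f y).
Proof. by move=> xy; rewrite /qcomm -[f y * _]rmorphM xy /= linearZ /= rmorphM. Qed.

Lemma qmat_tr_family k m : qfamily q (fun (i : 'I_k) (j : 'I_m) => @qmat_x F q m k j i).
Proof.
split=> [i t j lt_jt|i s lt_is]; first exact: qmat_x_col.
split=> [t|t j lt_tj|t j lt_jt]; first exact: qmat_x_row.
  by apply: esym; exact: qmat_x_comm.
have [_ _ rel3] := (qmat_x_family q m k).2 _ _ lt_jt.
by apply: etrans (rel3 _ _ lt_is) _; rewrite (qmat_x_comm q lt_jt lt_is).
Qed.

Lemma qcomm_tr k m e (A C : {set 'I_k}) (B D : {set 'I_m}) :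
  qcomm q e (qm q A B) (qm q C D) -> qcomm q e (qm q B A) (qm q D C).
Proof.
have [f fx] := qmat_universal (@qmat_tr_family k m).
suff fm U V : f (qm q U V) = qm q V U by rewrite -!fm; exact: qcomm_morph.
case: (#|U| =P #|V|) => [UV|nUV]; last first.
  by rewrite !qm_neq ?raddf0 // => VU; apply: nUV.
have [l [r [c [ri ci -> ->]]]] := incr_enum2 UV.
rewrite !qm_incr // qdet_morph [RHS]qdet_tr; last first.
  move=> a b i j ab ij; have [_ xrel] := @qmat_x_family F q m k.
  by case: (xrel _ _ (ci _ _ ab)) => _ /(_ _ _ (ri _ _ ij)) -> _.
by apply: eq_qdet => a b; rewrite fx.
Qed.
End Transposition.

(** * Elementary row operations *)

Section MatrixAlgebra.
Variables (F : fieldType) (S : algType F) (n : nat).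

(** Matrices over the noncommutative ring [S] are modules over [S] only; the
    alias carries their structure of algebra over [F]. *)
Definition mxalg := 'M[S]_n.+1.
HB.instance Definition _ := GRing.NzRing.on mxalg.
Implicit Types U V : mxalg.

Definition mxalg_scale c U : mxalg := map_mx ( *:%R c) U.

Fact mxalg_scaleA c d U : mxalg_scale c (mxalg_scale d U) = mxalg_scale (c * d) U.
Proof. by apply/matrixP=> i j; rewrite !mxE scalerA. Qed.
Fact mxalg_scale1 : left_id 1 mxalg_scale.
Proof. by move=> U; apply/matrixP=> i j; rewrite !mxE scale1r. Qed.
Fact mxalg_scaleDr : right_distributive mxalg_scale +%R.
Proof. by move=> c U V; apply/matrixP=> i j; rewrite !mxE scalerDr. Qed.
Fact mxalg_scaleDl U : {morph mxalg_scale^~ U : c d / c + d}.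
Proof. by move=> c d; apply/matrixP=> i j; rewrite !mxE scalerDl. Qed.
HB.instance Definition _ := GRing.Zmodule_isLmodule.Build F mxalg
  mxalg_scaleA mxalg_scale1 mxalg_scaleDr mxalg_scaleDl.

Fact mxalg_scaleAl c U V : c *: (U * V) = (c *: U) * V.
Proof.
apply/matrixP=> i j; rewrite !mxE scaler_sumr; apply: eq_bigr => k _.
by rewrite !mxE scalerAl.
Qed.
HB.instance Definition _ := GRing.Lmodule_isLalgebra.Build F mxalg mxalg_scaleAl.

Fact mxalg_scaleAr c U V : c *: (U * V) = U * (c *: V).
Proof.
apply/matrixP=> i j; rewrite !mxE scaler_sumr; apply: eq_bigr => k _.
by rewrite !mxE scalerAr.
Qed.
HB.instance Definition _ := GRing.Lalgebra_isAlgebra.Build F mxalg mxalg_scaleAr.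

(** The pure tensors of [mxalg], seen as the tensor product of scalar matrices
    with [S]. *)
Definition tens (M : 'M[F]_n.+1) (x : S) : mxalg := map_mx (fun c => c *: x) M.

Implicit Types M N : 'M[F]_n.+1.

Lemma tensE M x i j : tens M x i j = M i j *: x.
Proof. by rewrite mxE. Qed.

Lemma tensM M N x y : tens M x * tens N y = tens (M * N) (x * y).
Proof.
apply/matrixP=> i j; rewrite !mxE scaler_suml; apply: eq_bigr => k _.
by rewrite !mxE -scalerAl -scalerAr scalerA.
Qed.

Lemma tensDr M x y : tens M (x + y) = tens M x + tens M y.
Proof. by apply/matrixP=> i j; rewrite !mxE scalerDr. Qed.

Lemma tensZr M c x : tens M (c *: x) = c *: tens M x.
Proof. by apply/matrixP=> i j; rewrite !mxE !scalerA mulrC. Qed.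

Lemma tensZl M c x : tens (c *: M) x = c *: tens M x.
Proof. by apply/matrixP=> i j; rewrite !mxE scalerA. Qed.

Lemma tens0 M : tens M 0 = 0.
Proof. by apply/matrixP=> i j; rewrite !mxE scaler0. Qed.

Lemma tens1 : tens 1 1 = 1.
Proof. by apply/matrixP=> i j; rewrite !mxE; case: eqP => _; rewrite ?scale1r ?scale0r. Qed.

Lemma tens_prod (I : Type) (r : seq I) (M : I -> 'M[F]_n.+1) (x : I -> S) :
  \prod_(i <- r) tens (M i) (x i) = tens (\prod_(i <- r) M i) (\prod_(i <- r) x i).
Proof.
elim: r => [|i r IHr]; first by rewrite !big_nil tens1.
by rewrite !big_cons IHr tensM.
Qed.

Lemma qdet_tens (q : F) l (M : 'I_l -> 'M[F]_n.+1) (x : 'I_l -> 'I_l -> S) :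
  qdet q (fun a b => tens (M a) (x a b)) = tens (\prod_a M a) (qdet q x).
Proof.
have tens_sum (I : Type) (r : seq I) N (z : I -> S) :
    tens N (\sum_(i <- r) z i) = \sum_(i <- r) tens N (z i).
  by elim: r => [|i r IHr]; rewrite ?big_nil ?tens0 // !big_cons tensDr IHr.
rewrite /qdet tens_sum; apply: eq_bigr => s _.
by rewrite tens_prod tensZr.
Qed.

Section Rows.
Variables (q : F) (m : nat).
Implicit Types X Y : 'I_m -> S.

Lemma qrow_tens M X : qrow q X -> qrow q (fun j => tens M (X j)).
Proof. by move=> rX t j lt_jt; rewrite !tensM rX // tensZr. Qed.

Lemma qrel_tens M N X Y : M * N = N * M -> qrel q X Y ->
  qrel q (fun j => tens M (X j)) (fun j => tens N (Y j)).
Proof.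
move=> MN [r1 r2 r3]; split=> [t|t j lt|t j lt]; rewrite !tensM MN.
- by rewrite r1 tensZr.
- by rewrite r2.
- by rewrite r3 // tensDr tensZr.
Qed.
End Rows.
End MatrixAlgebra.

Section RowOperations.
Variables (F : fieldType) (q : F) (m : nat).
Hypothesis q0 : q != 0.

Lemma qrelDl (S : algType F) (X X' Y : 'I_m -> S) : qrel q X Y -> qrel q X' Y ->
  qrel q (fun j => X j + X' j) Y.
Proof.
move=> [r1 r2 r3] [r1' r2' r3']; split=> [t|t j lt|t j lt]; rewrite mulrDr mulrDl.
- by rewrite r1 r1' scalerDr.
- by rewrite r2 ?r2'.
- by rewrite r3 ?r3' // mulrDl scalerDr addrACA.
Qed.

Lemma qrelDr (S : algType F) (X Y Y' : 'I_m -> S) : qrel q X Y -> qrel q X Y' ->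
  qrel q X (fun j => Y j + Y' j).
Proof.
move=> [r1 r2 r3] [r1' r2' r3']; split=> [t|t j lt|t j lt]; rewrite mulrDl mulrDr.
- by rewrite r1 r1' scalerDr.
- by rewrite r2 ?r2'.
- by rewrite r3 ?r3' // mulrDr scalerDr addrACA.
Qed.

Variables (S : algType F) (n : nat) (D D' E : 'M[F]_n.+1) (X Y : 'I_m -> S).
Hypotheses (ED : E * D = q *: (D * E)) (D'E : D' * E = q *: (E * D')).
Hypotheses (DD' : D * D' = D' * D) (rX : qrow q X) (rY : qrow q Y) (rXY : qrel q X Y).

Let mixed (V : lmodType F) (a u v d : V) :
  q *: a + u + (q *: (v + (q - q^-1) *: u) + q *: d) =
  q *: (a + v + (q *: u + d)).
Proof.
have uE : u + (q * (q - q^-1)) *: u = q *: (q *: u).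
  by rewrite mulrBr mulfV // scalerBl scale1r addrC subrK scalerA.
rewrite !scalerDr scalerA -uE -!addrA; congr (_ + _).
exact: addrCA.
Qed.

Let square (V : lmodType F) (d : V) :
  q *: (q *: d) = d + (q - q^-1) *: (q *: d).
Proof. by rewrite !scalerA mulrBl mulVf // scalerBl scale1r addrC subrK. Qed.

(** The combined row comes first if its index is the smaller one ([raise]), and
    last otherwise ([lower]). *)
Lemma qrow_raise : qrow q (fun j => tens D (X j) + tens E (Y j)).
Proof.
case: rXY => _ r2 r3 t j lt.
rewrite !mulrDl !mulrDr !tensM ED !tensZl (r2 _ _ lt) (r3 _ _ lt) (rX lt) (rY lt).
by rewrite !tensZr tensDr tensZr mixed.
Qed.

Lemma qrow_lower : qrow q (fun j => tens E (X j) + tens D' (Y j)).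
Proof.
case: rXY => _ r2 r3 t j lt.
rewrite !mulrDl !mulrDr !tensM D'E !tensZl (r2 _ _ lt) (r3 _ _ lt) (rX lt) (rY lt).
by rewrite !tensZr tensDr tensZr mixed.
Qed.

Lemma qrel_raise : qrel q (fun j => tens D (X j) + tens E (Y j)) (fun j => tens D' (Y j)).
Proof.
case: rXY => r1 r2 r3; split=> [t|t j lt|t j lt].
- by rewrite mulrDr mulrDl !tensM r1 -DD' D'E tensZl tensZr scalerDr.
- by rewrite mulrDr mulrDl !tensM r2 // -DD' D'E (rY lt) tensZl tensZr.
rewrite mulrDr !mulrDl !tensM (r3 _ _ lt) -DD' D'E (rY lt) !tensZl !tensZr tensDr tensZr.
by rewrite square scalerDr addrACA.
Qed.

Lemma qrel_lower : qrel q (fun j => tens D (X j)) (fun j => tens E (X j) + tens D' (Y j)).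
Proof.
case: rXY => r1 r2 r3; split=> [t|t j lt|t j lt].
- by rewrite mulrDr mulrDl !tensM r1 -DD' ED !tensZl tensZr scalerDr.
- by rewrite mulrDr mulrDl !tensM (r2 _ _ lt) -DD' ED (rX lt) tensZl tensZr.
rewrite mulrDl !mulrDr !tensM (r3 _ _ lt) -DD' ED (rX lt) !tensZl !tensZr tensDr tensZr.
by rewrite square scalerDr addrACA.
Qed.
End RowOperations.

Section RowOperation.
Variables (F : fieldType) (q : F) (k m : nat).
Hypothesis q0 : q != 0.
Variables a b : 'I_k.
Hypothesis adj_ab : b = a.+1 :> nat \/ a = b.+1 :> nat.
Local Notation Q := (qmat q k m).
Local Notation x := (@qmat_x F q k m).

(** The conjugation factor of [shift] by the diagonal matrix [wtmx i]: the
    entries [(a, a)], [(a, b)] and [(b, b)] of a triangular quantum matrix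
    satisfy these relations. *)
Definition wt (i : 'I_k) : F :=
  if (a < b)%N then (if i == a then q else if i == b then q^-1 else 1)
  else (if i == a then q^-1 else if i == b then q else 1).

(** Size 3 leaves room for [shift ^+ 2 != 0], which is needed when both minors
    of a product are moved. *)
Definition wtmx (i : 'I_k) : 'M[F]_3 := diag_mx (\row_(j < 3) wt i ^+ j).
Definition shift : 'M[F]_3 := \matrix_(i, j) (j == i.+1 :> nat)%:R.

Lemma wtmxC i j : wtmx i * wtmx j = wtmx j * wtmx i.
Proof. exact: diag_mxC. Qed.

Lemma wtmx1 i : i != a -> i != b -> wtmx i = 1.
Proof.
move=> ia ib; apply/matrixP=> u v; rewrite !mxE /wt (negbTE ia) (negbTE ib).
by rewrite !if_same expr1n.
Qed.

Lemma shift_wtmx i : shift * wtmx i = wt i *: (wtmx i * shift).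
Proof.
apply/matrixP=> u v; rewrite [RHS]mxE -[wtmx i * shift]/(diag_mx _ *m shift).
have -> : shift * wtmx i = shift *m diag_mx (\row_(j < 3) wt i ^+ j) by [].
rewrite mul_mx_diag mul_diag_mx !mxE.
by case: eqP => [->|]; rewrite ?mul0r ?mulr0 // mul1r mulr1 exprS.
Qed.

Definition row_op (i : 'I_k) (j : 'I_m) : mxalg Q 2 :=
  tens (wtmx i) (x i j) + (if i == a then tens shift (x b j) else 0).

(** Since [a] and [b] are adjacent, any other row has the same position relative
    to both of them, and the relations with it are bilinear. *)
Lemma row_op_family : qfamily q row_op.
Proof.
have [xrow xrel] := @qmat_x_family F q k m.
have yN i : i != a -> row_op i = fun j => tens (wtmx i) (x i j).
  by move=> ia; apply/funext => j; rewrite /row_op (negbTE ia) addr0.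
have ya : row_op a = fun j => tens (wtmx a) (x a j) + tens shift (x b j).
  by apply/funext => j; rewrite /row_op eqxx.
have ya' : row_op a = fun j => tens shift (x b j) + tens (wtmx a) (x a j).
  by rewrite ya; apply/funext => j; rewrite addrC.
have aNb : a != b by apply/eqP => ab; move: adj_ab; rewrite ab; lia.
have com1 i : i != a -> i != b -> wtmx i * shift = shift * wtmx i.
  by move=> ia ib; rewrite wtmx1 // mul1r mulr1.
have wa : wt a = if (a < b)%N then q else q^-1 by rewrite /wt eqxx.
have wb : wt b = if (a < b)%N then q^-1 else q.
  by rewrite /wt [b == a]eq_sym (negbTE aNb) eqxx.
have wtE i : wtmx i * shift = (wt i)^-1 *: (shift * wtmx i).
  rewrite shift_wtmx scalerA mulVf ?scale1r // /wt.
  by do !case: ifP => _; rewrite ?oner_eq0 ?invr_eq0.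
split=> [i|i s lt_is].
  have [-> {i}|ia] := eqVneq i a; last by rewrite yN //; exact: qrow_tens.
  have [ab|ba] : (a < b)%N \/ (b < a)%N by move: adj_ab; lia.
    rewrite ya; apply: qrow_raise => //; last exact: xrel.
    by rewrite shift_wtmx wa ab.
  have ab : (a < b)%N = false by rewrite ltnNge (ltnW ba).
  rewrite ya'; apply: qrow_lower => //; last exact: xrel.
  by rewrite wtE wa ab invrK.
have xt (u v : 'I_k) : (u < v)%N ->
    qrel q (fun j => tens (wtmx u) (x u j)) (fun j => tens (wtmx v) (x v j)).
  by move=> uv; apply: qrel_tens; [exact: wtmxC|exact: xrel].
have [ia|ia] := eqVneq i a; have [sa|sa] := eqVneq s a; first by move: lt_is; rewrite ia sa ltnn.
- rewrite ia in lt_is *; rewrite [row_op s]yN //; have [sb|sb] := eqVneq s b.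
    rewrite sb ya in lt_is *; apply: qrel_raise => //; last exact: xrel.
    - by rewrite wtE wb lt_is invrK.
    - exact: wtmxC.
  rewrite ya; apply: qrelDl; first exact: xt.
  apply: qrel_tens; first by rewrite com1.
  by apply: xrel; move: adj_ab sb; rewrite -val_eqE /=; lia.
- rewrite sa in lt_is *; rewrite [row_op i]yN //; have [ib|ib] := eqVneq i b.
    rewrite ib ya' in lt_is *; apply: qrel_lower => //; last exact: xrel.
    - by rewrite shift_wtmx wb ltnNge (ltnW lt_is).
    - exact: wtmxC.
  rewrite ya; apply: qrelDr; first exact: xt.
  apply: qrel_tens; first by rewrite com1.
  by apply: xrel; move: adj_ab ib; rewrite -val_eqE /=; lia.
- by rewrite !yN //; exact: xt.
Qed.
End RowOperation.

(** * Moving a row index of a pair of quantum minors *)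

Section RowMove.
Variables (F : fieldType) (q : F) (k m : nat).
Hypothesis q0 : q != 0.
Variables a b : 'I_k.
Hypothesis adj_ab : b = a.+1 :> nat \/ a = b.+1 :> nat.
Local Notation Q := (qmat q k m).
Local Notation x := (@qmat_x F q k m).
Local Notation wgt := (wt q a b).
Local Notation wgtmx := (wtmx q a b).
Local Notation shift := (@shift F).

Definition movable (A : {set 'I_k}) := (a \in A) && (b \notin A).
Definition move (A : {set 'I_k}) := if movable A then b |: (A :\ a) else A.

Lemma adj_neq : a != b.
Proof. by apply/eqP => ab; move: adj_ab; rewrite ab; lia. Qed.

Lemma card_move A : #|move A| = #|A|.
Proof.
rewrite /move; case: ifP => // /andP[aA bA].
by rewrite cardsU1 !inE (negbTE bA) andbF (cardsD1 a A) aA.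
Qed.

Definition minor_wtmx (A : {set 'I_k}) : 'M[F]_3 :=
  diag_mx (\row_(j < 3) (\prod_(i in A) wgt i) ^+ j).

Lemma prod_wtmx l (r : 'I_l -> 'I_k) : incr r ->
  \prod_i wgtmx (r i) = minor_wtmx (r @: [set: 'I_l]).
Proof.
move=> ri; rewrite /minor_wtmx.
have -> : \prod_(i in r @: [set: 'I_l]) wgt i = \prod_i wgt (r i).
  rewrite big_imset /=; last by move=> ? ? _ _; exact: incr_inj.
  by apply: eq_bigl => i; rewrite inE.
elim/big_rec2: _ => [|i p w _ ->].
  by apply/matrixP=> u v; rewrite !mxE expr1n.
rewrite -[LHS]/(diag_mx _ *m diag_mx _) mulmx_diag; congr diag_mx.
by apply/rowP=> j; rewrite !mxE exprMn.
Qed.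

(** Expanding along row [a], the minor where row [a] is replaced by row [b]
    vanishes if [b] is already one of the rows, since these two rows are then
    consecutive. *)
Lemma qdet_row_op l (r : 'I_l -> 'I_k) (c : 'I_l -> 'I_m) : incr r -> incr c ->
  let A := r @: [set: 'I_l] in let B := c @: [set: 'I_l] in
  qdet q (fun i j => row_op q a b (r i) (c j)) =
  tens (minor_wtmx A) (qm q A B) +
  (if movable A then tens shift (qm q (move A) B) else 0).
Proof.
move=> ri ci A B; have qAB := qm_incr q ri ci; rewrite -/A -/B in qAB.
have base : qdet q (fun i j => tens (wgtmx (r i)) (x (r i) (c j))) =
    tens (minor_wtmx A) (qm q A B).
  by rewrite qdet_tens prod_wtmx // qAB.
have [aA|aA] := boolP (a \in A); last first.
  rewrite /movable (negbTE aA) addr0 -base; apply: eq_qdet => i j.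
  rewrite /row_op; case: eqP => [ria|]; last by rewrite addr0.
  by case/negP: aA; rewrite -ria imset_f.
have [i0 _ ai0] := imsetP aA.
pose r' i := if i == i0 then b else r i.
pose M i := if i == i0 then shift else wgtmx (r i).
have riE i : (r i == a) = (i == i0) by rewrite ai0 (inj_eq (incr_inj ri)).
rewrite (@qdetD _ _ _ _ i0 _ (fun i j => tens (wgtmx (r i)) (x (r i) (c j)))
  (fun i j => tens (M i) (x (r' i) (c j)))); first last.
- by move=> i j ii0; rewrite /row_op riE /M /r' (negbTE ii0) addr0.
- by move=> i j ii0; rewrite /row_op riE (negbTE ii0) addr0.
- by move=> j; rewrite /row_op riE /M /r' eqxx.
rewrite base qdet_tens; congr (_ + _); rewrite /move /movable aA /=.
have [bA|bA] := boolP (b \in A) => /=.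
  have [i1 _ bi1] := imsetP bA.
  have i10 : i1 != i0 by apply: contraNneq adj_neq => i10; rewrite ai0 bi1 i10.
  have r'1 : r' i1 = r' i0 by rewrite /r' eqxx (negbTE i10).
  have rmono (u v : 'I_l) : (u < v)%N = (r u < r v)%N.
    apply/idP/idP; first exact: ri.
    by rewrite !ltnNge; apply: contra; rewrite leq_eqVlt => /orP[/eqP/val_inj->//|/ri/ltnW].
  (* No index of [A] lies between the adjacent indices [a] and [b]. *)
  have between (u v : 'I_l) : r v = (r u).+1 :> nat -> v = u.+1 :> nat.
    move=> ruv; have uv : (u < v)%N by rewrite rmono ruv.
    apply/eqP; rewrite eqn_leq uv andbT leqNgt; apply/negP => u1v.
    have w_lt : (u.+1 < l)%N := leq_ltn_trans (ltnW u1v) (ltn_ord v).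
    have := rmono u (Ordinal w_lt); have := rmono (Ordinal w_lt) v.
    by rewrite /= ltnSn u1v ruv; lia.
  have q_eq (u v : 'I_l) : v = u.+1 :> nat -> r' v = r' u ->
      qdet q (fun i j => x (r' i) (c j)) = 0.
    move=> uv r'uv; apply: (qdet_eq_rows q0 uv) => [j|]; first by rewrite r'uv.
    by move=> t j lt_jt; apply: (qmat_x_family _ _ _).1; exact: ci.
  by case: adj_ab; rewrite ai0 bi1 => /between e; rewrite (q_eq _ _ e) ?r'1 ?tens0.
have r'i : incr r'.
  move=> u v uv; have := ri _ _ uv; rewrite /r'.
  have rb w : r w <> b :> nat.
    by move/val_inj=> rwb; case/negP: bA; rewrite -rwb imset_f.
  have := rb u; have := rb v; have ra : a = r i0 :> nat by rewrite ai0.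
  have [ui|ui] := eqVneq u i0; have [vi|vi] := eqVneq v i0;
    rewrite ?ui ?vi; move: uv adj_ab; rewrite ?ui ?vi; lia.
have -> : b |: A :\ a = r' @: [set: 'I_l].
  apply/setP=> y; rewrite !inE; apply/idP/imsetP => [|[i _ ->]].
    case/orP=> [/eqP->|/andP[ya /imsetP[i _ yi]]]; first by exists i0; rewrite /r' ?eqxx.
    by exists i; rewrite /r' -?riE -?yi ?(negbTE ya).
  rewrite /r'; have [_|ii0] := eqVneq i i0; rewrite ?eqxx //.
  by rewrite riE ii0 imset_f ?orbT.
rewrite (qm_incr q r'i ci); congr (tens _ _).
have M1 i : i != i0 -> M i = 1.
  move=> ii0; rewrite /M (negbTE ii0) wtmx1 ?riE //.
  by apply: contraNneq bA => <-; exact: imset_f.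
case: (path.splitPr (mem_index_enum i0)) (index_enum_uniq 'I_l) => r1 r2.
rewrite cat_uniq /= !negb_or => /and4P[_ /andP[n1 _] n2 _].
rewrite big_cat big_cons /= {2}/M eqxx !big1_seq ?mul1r ?mulr1 //.
  by move=> i /andP[_ ir]; apply: M1; apply: contraNneq n2 => <-.
by move=> i /andP[_ ir]; apply: M1; apply: contraNneq n1 => <-.
Qed.


Lemma row_op_minor : exists f : {lrmorphism Q -> mxalg Q 2}, forall A B,
  f (qm q A B) = tens (minor_wtmx A) (qm q A B) +
    (if movable A then tens shift (qm q (move A) B) else 0).
Proof.
have [f fx] := qmat_universal (row_op_family m q0 adj_ab); exists f => A B.
have [AB|AB] := #|A| =P #|B|; last first.
  by rewrite !qm_neq ?card_move // raddf0 !tens0 if_same addr0.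
have [l [r [c [ri ci -> ->]]]] := incr_enum2 AB.
rewrite {1}qm_incr // qdet_morph -qdet_row_op //.
by apply: eq_qdet => i j; exact: fx.
Qed.

Definition move_sign : int := if (a < b)%N then -1 else 1.

(** The eigenvalue of the diagonal part of an immobile minor on the second
    basis vector. *)
Lemma prod_wt A : ~~ movable A ->
  \prod_(u in A) wgt u = q ^ (move_sign *+ ((b \in A) && (a \notin A))).
Proof.
have aNb := adj_neq; have wa : wgt a = if (a < b)%N then q else q^-1.
  by rewrite /wt eqxx.
have wb : wgt b = if (a < b)%N then q^-1 else q.
  by rewrite /wt [b == a]eq_sym (negbTE aNb) eqxx.
have w1 (A' : {set 'I_k}) : a \notin A' -> b \notin A' -> \prod_(u in A') wgt u = 1.
  move=> aA bA; apply: big1 => u uA; rewrite /wt.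
  by rewrite (negbTE (memPn aA _ uA)) (negbTE (memPn bA _ uA)) !if_same.
rewrite /movable; have [aA|aA] := boolP (a \in A); have [bA|bA] := boolP (b \in A) => //= _.
- rewrite (big_setD1 a) //= (big_setD1 b) ?inE 1?eq_sym ?aNb //= w1 ?inE ?eqxx ?andbF //.
  by rewrite wa wb mulr1 mulr0n expr0z; case: ifP => _; rewrite ?mulfV ?mulVf.
- rewrite (big_setD1 b) //= w1 ?inE ?eqxx ?(negbTE aA) ?andbF // wb mulr1 mulr1n /move_sign.
  by case: ifP; rewrite ?exprN1 ?expr1z.
- by rewrite w1.
Qed.

(** The entries of highest degree in [shift] on both sides of the image of the
    commutation relation are compared.  When exactly one of the two minors moves,
    the diagonal part of the other one contributes to the exponent. *)
Lemma qcomm_move e (A C : {set 'I_k}) (B D : {set 'I_m}) : qcomm q e (qm q A B) (qm q C D) ->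
  qcomm q (e + move_sign *+ (movable A && ((b \in C) && (a \notin C)))
             - move_sign *+ (movable C && ((b \in A) && (a \notin A))))
    (qm q (move A) B) (qm q (move C) D).
Proof.
have [f fm] := row_op_minor; move=> /(qcomm_morph f); rewrite /qcomm !fm => E.
have addE (U V : mxalg Q 2) i j : (U + V) i j = U i j + V i j by exact: mxE.
have sclE c (U : mxalg Q 2) i j : (c *: U) i j = c *: U i j by exact: mxE.
have wtM A' (M : 'M[F]_3) i j : (minor_wtmx A' * M) i j = (\prod_(u in A') wgt u) ^+ i * M i j.
  by rewrite -[_ * _]/(_ *m _) mul_diag_mx !mxE.
have wtM' A' (M : 'M[F]_3) i j : (M * minor_wtmx A') i j = M i j * (\prod_(u in A') wgt u) ^+ j.
  by rewrite -[_ * _]/(_ *m _) mul_mx_diag !mxE.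
have shiftE (M : 'M[F]_3) (i i' : 'I_3) j : i' = i.+1 :> nat -> (shift * M) i j = M i' j.
  move=> ii'; rewrite -[_ * _]/(_ *m _) mxE (bigD1 i') //= mxE ii' eqxx mul1r.
  rewrite big1 ?addr0 // => u; rewrite -val_eqE mxE /= ii' => /negbTE ->.
  by rewrite mul0r.
have sh (i j : 'I_3) : shift i j = (j == i.+1 :> nat)%:R by rewrite mxE.
have dd A' C' (j : 'I_3) : j != 0 -> (minor_wtmx A' * minor_wtmx C') 0 j = 0.
  by move=> j0; rewrite wtM mxE eq_sym (negbTE j0) mulr0.
have ds A' (j : 'I_3) : (minor_wtmx A' * shift) 0 j = shift 0 j.
  by rewrite wtM expr0 mul1r.
have sdE A' (j : 'I_3) :
    (shift * minor_wtmx A') 0 j = (\prod_(u in A') wgt u) *+ (j == 1).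
  by rewrite (shiftE _ 0 1) // !mxE eq_sym.
have sd1 A' : (shift * minor_wtmx A') 0 1 = \prod_(u in A') wgt u by rewrite sdE.
have sd2 A' : (shift * minor_wtmx A') 0 2 = 0 by rewrite sdE.
have ss : (shift * shift) 0 2 = 1 :> F by rewrite (shiftE _ 0 1) // sh.
have ne A' : movable A' -> (b \in A') && (a \notin A') = false.
  by rewrite /movable => /andP[->]; rewrite andbF.
have [mA|mA] := boolP (movable A); have [mC|mC] := boolP (movable C);
  rewrite ?(ne _ mA) ?(ne _ mC) ?mulr0n ?addr0 ?subr0 /=.
- move/matrixP/(_ 0 2): E; rewrite mA mC !mulrDl !mulrDr !tensM sclE !addE !tensE.
  by rewrite !dd // !ds !sd2 ss !sh !scale0r !scale1r !add0r.
- move/matrixP/(_ 0 1): E; rewrite mA (negbTE mC) !addr0 !mulrDl !mulrDr !tensM.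
  rewrite sclE !addE !tensE !dd // !ds !sd1 !sh !scale0r !add0r !scale1r.
  have -> : move C = C by rewrite /move (negbTE mC).
  by move=> ->; rewrite scalerA (prod_wt mC) -(expfzDr _ _ q0).
- move/matrixP/(_ 0 1): E; rewrite (negbTE mA) mC !addr0 !mulrDl !mulrDr !tensM.
  rewrite sclE !addE !tensE !dd // !ds !sd1 !sh !scale0r !add0r !scale1r.
  have -> : move A = A by rewrite /move (negbTE mA).
  rewrite (expfzDr _ _ q0) mulrC -scalerA => <-.
  by rewrite scalerA (prod_wt mA) -(expfzDr _ _ q0) addNr expr0z scale1r.
- move/matrixP/(_ 0 0): E; rewrite (negbTE mA) (negbTE mC) !addr0 !tensM sclE !tensE.
  by rewrite !wtM !mxE /= !expr0 mul1r !scale1r /move (negbTE mA) (negbTE mC).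
Qed.

End RowMove.

(** * Pairs of minors as words *)

(** The row indices of a pair of minors [(A, B)], [(C, D)] are recorded by the
    list of the pairs [(i \in A, i \in C)], and similarly for the columns. *)
Definition state : eqType := (bool * bool)%type.
Definition lset k (l : seq bool) : {set 'I_k} := [set i : 'I_k | nth false l i].

Lemma card_lset k l : size l = k -> #|lset k l| = count id l.
Proof.
move=> <-; rewrite -sum1_card -sum1_count (big_nth false) big_mkord.
by apply: eq_bigl => i; rewrite inE.
Qed.

Lemma nth_pair (l1 l2 : seq bool) u v i :
  nth false (l1 ++ u :: v :: l2) i =
  if i == size l1 then u else if i == (size l1).+1 then v
  else nth false (l1 ++ false :: false :: l2) i.
Proof.
by elim: l1 i => [|w l1 IHl] [|[|i]] //=; rewrite ?IHl.
Qed.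

(** On the membership bits of two adjacent indices, moving down takes the pair
    [(u, v)] to [(u && v, u || v)], and moving up to [(u || v, u && v)]. *)
Lemma move_lset k (a b : 'I_k) l1 l2 u v :
  (a = size l1 :> nat /\ b = (size l1).+1 :> nat ->
     move a b (lset k (l1 ++ u :: v :: l2)) =
     lset k (l1 ++ (u && v) :: (u || v) :: l2)) /\
  (a = (size l1).+1 :> nat /\ b = size l1 :> nat ->
     move a b (lset k (l1 ++ u :: v :: l2)) =
     lset k (l1 ++ (u || v) :: (u && v) :: l2)).
Proof.
have inE2 (w z : bool) (i : 'I_k) : (i \in lset k (l1 ++ w :: z :: l2)) =
    if i == size l1 :> nat then w else if i == (size l1).+1 :> nat then z
    else nth false (l1 ++ false :: false :: l2) i.
  by rewrite inE nth_pair.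
have eqn (i j : 'I_k) : (i == j) = (nat_of_ord i == nat_of_ord j) by [].
have ne : ((size l1).+1 == size l1) = false by apply/negbTE; rewrite gtn_eqF.
split=> -[pa pb]; apply/setP=> i; rewrite /move /movable [a \in _]inE2 [b \in _]inE2;
  rewrite pa pb ?eqxx ?ne; case: ifP => uv; rewrite ?in_setU1 ?in_setD1 !inE2 ?eqn ?pa ?pb;
  case: (_ =P size l1) => [ip|_]; rewrite ?ip ?eqxx 1?[_ == _.+1]eq_sym ?ne ?orbF ?andbF //=;
  try (by case: u v uv => [] []);
  case: eqP => //= _; by case: u v uv => [] [].
Qed.

(** The word of a pair: the letters of the rows which lie in exactly one of
    the two minors; [true] stands for the first minor. *)
Definition letters (s : seq state) := [seq x.1 | x <- s & x.1 != x.2].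
Definition letter b : state := (b, ~~ b).

(** The normal form of a list with word [w]: rows in both minors first, rows in
    none of them last. *)
Definition nform n w l : seq state :=
  nseq n (true, true) ++ map letter w ++ nseq l (false, false).

Lemma size_count (s : seq state) :
  size s = (count_mem (true, true) s + size (letters s) + count_mem (false, false) s)%N.
Proof.
by rewrite size_map size_filter; elim: s => [|[[] []] s] //= ->; lia.
Qed.

Lemma count1 (s : seq state) :
  count id [seq x.1 | x <- s] = (count_mem (true, true) s + count id (letters s))%N.
Proof. by elim: s => [|[[] []] s] //=; rewrite /letters /= => ->; lia. Qed.

Lemma count2 (s : seq state) :
  count id [seq x.2 | x <- s] = (count_mem (true, true) s + count negb (letters s))%N.
Proof. by elim: s => [|[[] []] s] //=; rewrite /letters /= => ->; lia. Qed.

Section Words.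
Variables (F : fieldType) (q : F).
Hypothesis q0 : q != 0.
Implicit Types (s t : seq state) (x y : state).

Definition lset1 k s := lset k [seq x.1 | x <- s].
Definition lset2 k s := lset k [seq x.2 | x <- s].

Definition lcomm k m e s t :=
  qcomm q e (qm q (lset1 k s) (lset1 m t)) (qm q (lset2 k s) (lset2 m t)).

Lemma lcomm_tr k m e s t : lcomm k m e s t -> lcomm m k e t s.
Proof. exact: qcomm_tr. Qed.

Definition meet x y : state := (x.1 && y.1, x.2 && y.2).
Definition join x y : state := (x.1 || y.1, x.2 || y.2).

(** Both minors are moved at once; the exponent changes only if the two rows
    lie in different minors, one in each. *)
Lemma lcomm_raise k m e s1 s2 x y t : size (s1 ++ x :: y :: s2) = k ->
  lcomm k m e (s1 ++ x :: y :: s2) t ->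
  lcomm k m (e - ((x.1 && ~~ y.1) && (y.2 && ~~ x.2))%:R
               + ((x.2 && ~~ y.2) && (y.1 && ~~ x.1))%:R)
    (s1 ++ meet x y :: join x y :: s2) t.
Proof.
move=> sz; have lt_b : ((size s1).+1 < k)%N by rewrite -sz size_cat /=; lia.
pose b := Ordinal lt_b; pose a := Ordinal (ltnW lt_b).
rewrite /lcomm /lset1 /lset2 !map_cat /= => /(qcomm_move q0 (a := a) (b := b)).
have ab : b = a.+1 :> nat \/ a = b.+1 :> nat by left.
have mv (g : state -> bool) z w : move a b (lset k (map g s1 ++ z :: w :: map g s2)) =
    lset k (map g s1 ++ (z && w) :: (z || w) :: map g s2).
  by apply: (move_lset _ _ _ _ _ _).1; rewrite size_map.
have inb (g : state -> bool) z w : (b \in lset k (map g s1 ++ z :: w :: map g s2)) = w.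
  by rewrite inE nth_pair size_map /= eqxx gtn_eqF.
have ina (g : state -> bool) z w : (a \in lset k (map g s1 ++ z :: w :: map g s2)) = z.
  by rewrite inE nth_pair size_map /= eqxx.
move/(_ ab); rewrite !mv /movable !ina !inb /move_sign /= ltnSn.
by rewrite !mulNrn opprK.
Qed.

(** Only [(true, false)] and [(false, true)] are not comparable: these are the
    rows which lie in exactly one minor, but not in the same one. *)
Definition comparable x y :=
  ((x.1 ==> y.1) && (x.2 ==> y.2)) || ((y.1 ==> x.1) && (y.2 ==> x.2)).

(** If [x] and [y] are comparable, moving both minors in the right direction
    exchanges them, and neither case where the exponent changes occurs. *)
Lemma lcomm_swap k m e s1 s2 x y t : size (s1 ++ x :: y :: s2) = k ->
  comparable x y ->
  lcomm k m e (s1 ++ x :: y :: s2) t -> lcomm k m e (s1 ++ y :: x :: s2) t.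
Proof.
move=> sz /orP[] /andP[xy1 xy2]; last first.
  move/(lcomm_raise sz).
  have -> : (x.1 && ~~ y.1) && (y.2 && ~~ x.2) = false.
    by case: (x.2) (y.2) xy2 => [] []; rewrite ?andbF.
  have -> : (x.2 && ~~ y.2) && (y.1 && ~~ x.1) = false.
    by case: (x.1) (y.1) xy1 => [] []; rewrite ?andbF.
  have -> : meet x y = y by rewrite /meet; case: x y xy1 xy2 {sz} => [[] []] [[] []].
  have -> : join x y = x by rewrite /join; case: x y xy1 xy2 {sz} => [[] []] [[] []].
  by rewrite subr0 addr0.
have lt_b : ((size s1).+1 < k)%N by rewrite -sz size_cat /=; lia.
pose a := Ordinal lt_b; pose b := Ordinal (ltnW lt_b).
rewrite /lcomm /lset1 /lset2 !map_cat /= => /(qcomm_move q0 (a := a) (b := b)).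
have ab : b = a.+1 :> nat \/ a = b.+1 :> nat by right.
have mv (g : state -> bool) z w : move a b (lset k (map g s1 ++ z :: w :: map g s2)) =
    lset k (map g s1 ++ (z || w) :: (z && w) :: map g s2).
  by apply: (move_lset _ _ _ _ _ _).2; rewrite size_map.
have ina (g : state -> bool) z w : (a \in lset k (map g s1 ++ z :: w :: map g s2)) = w.
  by rewrite inE nth_pair size_map /= eqxx gtn_eqF.
have inb (g : state -> bool) z w : (b \in lset k (map g s1 ++ z :: w :: map g s2)) = z.
  by rewrite inE nth_pair size_map /= eqxx.
move/(_ ab); rewrite !mv /movable !ina !inb.
have -> : (y.1 && ~~ x.1) && (x.2 && ~~ y.2) = false.
  by case: (x.2) (y.2) xy2 => [] []; rewrite ?andbF.
have -> : (y.2 && ~~ x.2) && (x.1 && ~~ y.1) = false.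
  by case: (x.1) (y.1) xy1 => [] []; rewrite ?andbF.
have -> : x.1 && y.1 = x.1 by case: (x.1) (y.1) xy1 => [] [].
have -> : x.1 || y.1 = y.1 by case: (x.1) (y.1) xy1 => [] [].
have -> : x.2 && y.2 = x.2 by case: (x.2) (y.2) xy2 => [] [].
have -> : x.2 || y.2 = y.2 by case: (x.2) (y.2) xy2 => [] [].
by rewrite !mulr0n subr0 addr0.
Qed.

Lemma comparable_sym x y : comparable x y = comparable y x.
Proof. exact: orbC. Qed.

Definition leqv k m s s' := forall e t, lcomm k m e s t <-> lcomm k m e s' t.

Lemma leqv_pass k m x u s1 s2 : size (s1 ++ x :: u ++ s2) = k -> all (comparable x) u ->
  leqv k m (s1 ++ x :: u ++ s2) (s1 ++ u ++ x :: s2).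
Proof.
elim: u s1 => [|y u IHu] s1 //= sz /andP[xy xu] e t.
have sz' : size (s1 ++ y :: x :: u ++ s2) = k by rewrite -sz !size_cat.
apply: (iff_trans (B := lcomm k m e (s1 ++ y :: x :: u ++ s2) t)).
  by split; apply: lcomm_swap; rewrite // comparable_sym.
have := IHu (rcons s1 y); rewrite -!cats1 -!catA /=; apply => //.
Qed.

(** A row in both minors or in none of them can pass any other row. *)
Lemma leqv_nform k m s0 s : size (s0 ++ s) = k ->
  leqv k m (s0 ++ s)
    (s0 ++ nform (count_mem (true, true) s) (letters s) (count_mem (false, false) s)).
Proof.
elim: s s0 => [|x s IHs] s0 sz e t; first by [].
have := IHs (rcons s0 x); rewrite -!cats1 -!catA /= => /(_ sz e t) E.
apply: (iff_trans E) => {E}.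
set n := count_mem _ _; set l := count_mem _ _.
have sz_nf : size (nform n (letters s) l) = size s.
  rewrite /nform !size_cat !size_nseq /letters !size_map size_filter /n /l.
  by elim: s {IHs sz n l} => [|[[] []] s] //=; lia.
have sz1 : size (s0 ++ x :: nform n (letters s) l) = k.
  by rewrite -sz !size_cat /= sz_nf.
have pass b w : size (s0 ++ letter b :: nform n w l) = k ->
    leqv k m (s0 ++ letter b :: nform n w l) (s0 ++ nform n (b :: w) l).
  by move=> szw; apply: leqv_pass => //; rewrite all_nseq orbC; case: b {szw}.
case: x sz sz1 {IHs} => [[] []] sz sz1 //=.
- exact: (pass true).
- exact: (pass false).
rewrite -[nform _ _ _ in X in X <-> _]cats0.
have -> : nform n (letters s) l.+1 = nform n (letters s) l ++ [:: (false, false)].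
  by rewrite /nform -!catA -addn1 nseqD.
by apply: leqv_pass; rewrite ?cats0 //; apply/allP => -[[] []].
Qed.

Theorem leqv_letters k m s s' : size s = k -> size s' = k ->
  letters s = letters s' -> count_mem (true, true) s = count_mem (true, true) s' ->
  leqv k m s s'.
Proof.
move=> sk s'k ss' nn e t; have := leqv_nform (s0 := [::]) m sk e t.
have := leqv_nform (s0 := [::]) m s'k e t; rewrite !cat0s -ss' -nn.
have -> : count_mem (false, false) s' = count_mem (false, false) s.
  by have := size_count s; have := size_count s'; rewrite sk s'k -ss' -nn; lia.
by move=> E1 E2; apply: (iff_trans E2); apply: iff_sym.
Qed.
End Words.

(** * The commutation exponent read off a word *)

Lemma letters_cat s1 s2 : letters (s1 ++ s2) = letters s1 ++ letters s2.
Proof. by rewrite /letters filter_cat map_cat. Qed.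

Lemma letters_cons x s :
  letters (x :: s) = (if x.1 != x.2 then [:: x.1] else [::]) ++ letters s.
Proof. by rewrite /letters /=; case: ifP. Qed.

Lemma letters_nseq n b : letters (nseq n (b, b)) = [::].
Proof. by rewrite /letters; elim: n => //= n; rewrite eqxx. Qed.

Lemma letters_letter w : letters (map letter w) = w.
Proof. by elim: w => [|[] w IHw] //=; rewrite /letters /= -/(letters _) IHw. Qed.

Lemma card_lset_le k l : (size l <= k)%N -> #|lset k l| = count id l.
Proof.
move=> lk; have -> : lset k l = lset k (l ++ nseq (k - size l) false).
  apply/setP=> i; rewrite !inE nth_cat; case: ltnP => // li.
  by rewrite nth_nseq nth_default // if_same.
by rewrite card_lset ?size_cat ?size_nseq ?subnKC // count_cat count_nseq /= mul0n addn0.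
Qed.

Lemma lset_pad k l n : lset k (l ++ nseq n false) = lset k l.
Proof.
apply/setP=> i; rewrite !inE nth_cat; case: ltnP => // li.
by rewrite nth_nseq if_same nth_default.
Qed.

(** The height reached by the path with steps up [true] and down [false]. *)
Definition bal (l : seq bool) : int := (count id l)%:Z - (count negb l)%:Z.

Lemma bal_cat l1 l2 : bal (l1 ++ l2) = bal l1 + bal l2.
Proof. by rewrite /bal !count_cat; lia. Qed.

Lemma find_peak (r : seq bool) : (exists r1 r2, r = r1 ++ true :: false :: r2) \/
  exists a b, r = nseq a false ++ nseq b true.
Proof.
elim: r => [|x r [[r1 [r2 ->]]|[a [b ->]]]]; first by right; exists 0%N, 0%N.
  by left; exists (x :: r1), r2.
case: x; last by right; exists a.+1, b.
case: a => [|a]; first by right; exists 0%N, b.+1.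
by left; exists [::], (nseq a false ++ nseq b true).
Qed.

Lemma peak_prefix r1 r2 p p' : r1 ++ r2 = p ++ p' ->
  exists p0 p0', r1 ++ true :: false :: r2 = p0 ++ p0' /\ bal p0 = bal p.
Proof.
elim: r1 p => [|x r1 IHr] [|y p] /=.
- by move=> _; exists [::], [:: true, false & r2].
- move=> ->; exists [:: true, false, y & p], p'; split=> //.
  by rewrite -[true :: _]/([:: true; false] ++ y :: p) bal_cat add0r.
- by move=> _; exists [::], (x :: r1 ++ [:: true, false & r2]).
case=> <- /IHr[p0 [p0' [-> bp]]]; exists (x :: p0), p0'; split=> //.
by rewrite -(cat1s x p0) -(cat1s x p) !bal_cat bp.
Qed.

Section DiagonalCharacter.
Variables (F : fieldType) (q : F).

(** Setting the diagonal generators to 1 and the others to 0 is a character of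
    quantum matrices, which sends to 1 the minors with equal row and column
    index sets. *)
Lemma diag_family k m : qfamily q (fun (i : 'I_k) (j : 'I_m) => (i == j :> nat)%:R : F^o).
Proof.
have Z (b1 b2 : bool) : ~~ (b1 && b2) -> b1%:R * b2%:R = 0 :> F^o.
  by case: b1 b2 => [] [] // _; rewrite ?mulr0 ?mul0r.
split=> [i t j lt_jt|i s lt_is]; last split=> [t|t j lt|t j lt].
- by rewrite !Z ?scaler0 //; lia.
- by rewrite !Z ?scaler0 //; lia.
- by rewrite mulrC.
- by rewrite [X in _ *: X]Z ?scaler0 ?addr0 1?mulrC //; lia.
Qed.

Lemma diag_char k m : exists f : {lrmorphism qmat q k m -> F^o},
  forall l, (size l <= k)%N -> (size l <= m)%N -> f (qm q (lset k l) (lset m l)) = 1.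
Proof.
have [f fx] := qmat_universal (@diag_family k m); exists f => l lk lm.
have cd : #|lset k l| = #|lset m l| by rewrite !card_lset_le.
have [n [r [c [ri ci er ec]]]] := incr_enum2 cd; rewrite er ec qm_incr // qdet_morph.
have rc a : r a = c a :> nat.
  have wr : incr (widen_ord (leq_maxl k m) \o r) by move=> u v /ri.
  have wc : incr (widen_ord (leq_maxr k m) \o c) by move=> u v /ci.
  suff eq_im : (widen_ord (leq_maxl k m) \o r) @: [set: 'I_n] =
               (widen_ord (leq_maxr k m) \o c) @: [set: 'I_n].
    exact: (congr1 val (incr_unique wr wc eq_im a)).
  rewrite (imset_comp (widen_ord _) r) (imset_comp (widen_ord _) c) -er -ec; apply/setP=> i.
  have im n' (le_n : (n' <= maxn k m)%N) : (size l <= n')%N ->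
      (i \in widen_ord le_n @: lset n' l) = nth false l i.
    move=> ln; apply/imsetP/idP => [[u]|li]; first by rewrite inE => lu ->.
    have ls : (i < n')%N.
      by apply: leq_trans ln; rewrite ltnNge; apply: contraL li => /(nth_default _) ->.
    by exists (Ordinal ls); rewrite ?inE //; apply: val_inj.
  by rewrite !im.
rewrite /qdet (bigD1 (1%g : 'S_n)) //= [X in _ + X]big1 => [|s s1]; last first.
  have [a sa] : exists a, s a != a.
    apply/existsP; rewrite -negb_forall; apply: contra s1 => /forallP sP.
    by apply/eqP/permP => a; rewrite perm1; exact/eqP.
  suff -> : \prod_(i < n) f (qmat_x q (r i) (c (s i))) = 0 by rewrite scaler0.
  apply: (@eqP F); apply/(@prodf_eq0 F); exists a => //.
  rewrite fx rc; have [e|_] := c a =P c (s a) :> nat; last exact: eqxx.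
  by move: sa; rewrite -(incr_inj ci (val_inj e)) eqxx.
rewrite addr0 big1 => [|a _]; last by rewrite fx perm1 rc eqxx.
rewrite [perm_length _](_ : _ = 0%N) ?expr0 ?invr1 ?scale1r //.
apply: eq_card0 => -[a b]; rewrite !inE !perm1 /=.
by apply/negP => /andP[ab ba]; have := ltn_trans ab ba; rewrite ltnn.
Qed.

End DiagonalCharacter.

Section Exponent.
Variables (F : fieldType) (q : F).

(** Some pair with words [r] and [w] commutes up to [q ^ e]; by [leqv_letters],
    all the pairs of minors of the same sizes with these words then do. *)
Definition wcomm k m e r w := exists s t : seq state,
  [/\ size s = k /\ size t = m,
      count id [seq x.1 | x <- s] = count id [seq x.1 | x <- t],
      count id [seq x.2 | x <- s] = count id [seq x.2 | x <- t],
      letters s = r /\ letters t = w & lcomm q k m e s t].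

Lemma wcomm_bal k m e r w : wcomm k m e r w -> bal r = bal w.
Proof.
case=> s [t [_ c1 c2 [<- <-] _]]; move: c1 c2; rewrite /bal.
by rewrite (count1 s) (count1 t) (count2 s) (count2 t); lia.
Qed.

Hypothesis q0 : q != 0.

Lemma wcomm_tr k m e r w : wcomm k m e r w -> wcomm m k e w r.
Proof.
case=> s [t [[sk tm] c1 c2 [lr lw] st]]; exists t, s; split=> //.
exact: lcomm_tr.
Qed.

Lemma wcomm_swap k m e r w :
  wcomm k m e r w -> wcomm k m (- e) (map negb r) (map negb w).
Proof.
case=> s [t [[sk tm] c1 c2 [<- <-] st]].
pose f (x : state) : state := (x.2, x.1).
have sw u : letters (map f u) = map negb (letters u).
  by elim: u => [|[[] []] u IHu] //=; rewrite /letters /= -!/(letters _) IHu.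
have f1 u : [seq x.1 | x <- map f u] = [seq x.2 | x <- u] by rewrite -map_comp.
have f2 u : [seq x.2 | x <- map f u] = [seq x.1 | x <- u] by rewrite -map_comp.
exists (map f s), (map f t); rewrite !size_map !sw !f1 !f2; split=> //.
have e1 n u : lset1 n (map f u) = lset2 n u by rewrite /lset1 f1.
have e2 n u : lset2 n (map f u) = lset1 n u by rewrite /lset2 f2.
by rewrite /lcomm !e1 !e2; exact: qcomm_sym.
Qed.

(** After normalization the two letters are adjacent rows, and the row operation
    turns them into a row of none and a row of both minors. *)
Lemma wcomm_cancel k m e b r1 r2 w :
  wcomm k m e (r1 ++ b :: ~~ b :: r2) w ->
  wcomm k m (e - (if b then 1 else -1)) (r1 ++ r2) w.
Proof.
case=> s [t [[sk tm] c1 c2 [lr lw] st]].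
set n := count_mem (true, true) s; set l := count_mem (false, false) s.
pose s1 := nseq n (true, true) ++ map letter r1.
pose s2 := map letter r2 ++ nseq l (false, false).
have ls1 : letters s1 = r1 by rewrite letters_cat letters_nseq letters_letter.
have ls2 : letters s2 = r2 by rewrite letters_cat letters_nseq letters_letter cats0.
pose s' := s1 ++ letter b :: letter (~~ b) :: s2.
have ls' : letters s' = letters s.
  by rewrite lr letters_cat ls1 !letters_cons ls2; case: (b).
have ns' : count_mem (true, true) s' = n.
  rewrite /s' /s1 /s2 !count_cat /= !count_cat !count_nseq /= mul1n mul0n.
  have cl u : count_mem (true, true) (map letter u) = 0%N by elim: u => [|[]].
  by rewrite !cl !addn0; case: (b); rewrite !addn0.
have sz' : size s' = k.
  rewrite -sk (size_count s) lr -/n -/l /s' !size_cat /= !size_cat !size_nseq !size_map.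
  by lia.
have := (leqv_letters q0 m sk sz' (esym ls') (esym ns') e t).1 st.
move/(lcomm_raise q0 sz').
have -> : meet (letter b) (letter (~~ b)) = (false, false) by case: (b).
have -> : join (letter b) (letter (~~ b)) = (true, true) by case: (b).
have -> : (e - ((letter b).1 && ~~ (letter (~~ b)).1 &&
      ((letter (~~ b)).2 && ~~ (letter b).2))%:R +
    ((letter b).2 && ~~ (letter (~~ b)).2 &&
      ((letter (~~ b)).1 && ~~ (letter b).1))%:R) = e - (if b then 1 else -1) :> int.
  by case: (b) => /=; rewrite ?addr0 ?subr0 ?opprK.
move=> st'; exists (s1 ++ (false, false) :: (true, true) :: s2), t.
have ls'' : letters (s1 ++ (false, false) :: (true, true) :: s2) = r1 ++ r2.
  by rewrite letters_cat ls1 !letters_cons ls2.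
have ns'' : count_mem (true, true) (s1 ++ (false, false) :: (true, true) :: s2) = n.+1.
  by move: ns'; rewrite /s' !count_cat /=; case: (b) => /=; lia.
split=> //; first by split=> //; rewrite -sz' /s' !size_cat.
- by rewrite -c1 (count1 s) (count1 (s1 ++ _)) ls'' ns'' lr -/n !count_cat /=; case: (b); lia.
- by rewrite -c2 (count2 s) (count2 (s1 ++ _)) ls'' ns'' lr -/n !count_cat /=; case: (b); lia.
Qed.

Hypothesis q_inf : forall e : int, q ^ e = 1 -> e = 0.

(** Pairs with equal words for the rows and for the columns can be moved so that
    both minors have equal row and column index sets. *)
Lemma wcomm_same k m e r : wcomm k m e r r -> e = 0.
Proof.
case=> s [t [[sk tm] c1 _ [ls lt] st]].
pose n := count_mem (true, true) s; pose l := nseq n (true, true) ++ map letter r.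
have nt : count_mem (true, true) t = n.
  by move: c1; rewrite (count1 s) (count1 t) ls lt -/n; lia.
have ll : letters l = r by rewrite letters_cat letters_nseq letters_letter.
have nl : count_mem (true, true) l = n.
  rewrite count_cat count_nseq /= mul1n; have -> : count_mem (true, true) (map letter r) = 0%N.
    by elim: (r) => [|[]].
  by rewrite addn0.
have sl : size l = (n + size r)%N by rewrite size_cat size_nseq size_map.
have pad u K : size u = K -> letters u = r -> count_mem (true, true) u = n ->
    (size l <= K)%N /\ exists2 v, size v = K & [/\ letters u = letters v,
      count_mem (true, true) u = count_mem (true, true) v,
      lset1 K v = lset K [seq x.1 | x <- l] & lset2 K v = lset K [seq x.2 | x <- l]].
  move=> <- lu nu; have lK : (size l <= size u)%N.
    by rewrite (size_count u) sl lu nu leq_addr.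
  split=> //; exists (l ++ nseq (size u - size l) (false, false)).
    by rewrite size_cat size_nseq subnKC.
  rewrite letters_cat letters_nseq cats0 lu ll count_cat count_nseq nl addn0 nu.
  by rewrite /lset1 /lset2 !map_cat !map_nseq !lset_pad.
have [lk [s' sk' [ss' ns' s1 s2]]] := pad s k sk ls erefl.
have [lm [t' tm' [tt' nt' t1 t2]]] := pad t m tm lt nt.
have := (leqv_letters q0 m sk sk' ss' ns' e t).1 st.
move/lcomm_tr/(leqv_letters q0 k tm tm' tt' nt' e s').1/lcomm_tr.
have [f f1] := diag_char q k m; rewrite /lcomm s1 s2 t1 t2 => /(qcomm_morph f).
rewrite /qcomm !f1 ?size_map // => E; apply: q_inf.
by rewrite mulr1 in E; rewrite -[q ^ e]mulr1; exact: (esym E).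
Qed.

(** As long as there is a factor [true, false], it is cancelled: this removes a
    peak of the path of [r] or [w], and the points of the remaining path are
    points of the initial one.  If there is none, the words are
    [false ^ a true ^ b] and [false ^ c true ^ d] with [b - a = d - c], and
    cancelling [a - c] or [c - a] factors [false, true] makes them equal. *)
Lemma wcomm_exponent k m e r w : wcomm k m e r w -> exists p p',
  (r = p ++ p' \/ w = p ++ p') /\
  e = (count negb r + count negb w)%N%:Z + bal p *+ 2.
Proof.
have [n] := ubnP (size r + size w); elim: n k m e r w => // n IHn k m e r w.
have step k' m' e' r' w' : (size r' + size w' < n.+1)%N -> wcomm k' m' e' r' w' ->
  (exists r1 r2, r' = r1 ++ true :: false :: r2) -> exists p p',
    (r' = p ++ p' \/ w' = p ++ p') /\
    e' = (count negb r' + count negb w')%N%:Z + bal p *+ 2.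
  move=> lt_n rw [r1 [r2 Er]]; rewrite {}Er in lt_n rw *.
  have /IHn : (size (r1 ++ r2) + size w' < n)%N by move: lt_n; rewrite !size_cat /=; lia.
  move=> /(_ _ _ _ (wcomm_cancel (b := true) rw)) [p [p' [pp' E]]].
  have cn : count negb (r1 ++ true :: false :: r2) = (count negb (r1 ++ r2)).+1.
    by rewrite !count_cat /=; lia.
  case: pp' => [/peak_prefix[p0 [p0' [E0 bp]]]|Ew].
    by exists p0, p0'; split; [left|rewrite cn bp; lia].
  by exists p, p'; split; [right|rewrite cn; lia].
move=> lt_n rw; have [|[a [b Er]]] := find_peak r; first exact: (step k m).
have [|[c [d Ew]]] := find_peak w.
  move=> /(step _ _ _ _ _ _ (wcomm_tr rw)); rewrite addnC => /(_ lt_n) [p [p' [pp' ->]]].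
  by exists p, p'; split; [case: pp'; [right|left]|rewrite addnC].
have valley k' m' e' a' b' i w' :
    wcomm k' m' e' (nseq (a' + i) false ++ nseq (b' + i) true) w' ->
    wcomm k' m' (e' + i%:Z) (nseq a' false ++ nseq b' true) w'.
  elim: i e' => [|i IHi] e'; first by rewrite !addn0 addr0.
  rewrite !addnS -[X in nseq X false]addn1 nseqD -catA /= => /(wcomm_cancel (b := false)).
  by rewrite opprK => /IHi; rewrite -addrA -intS.
have bF n' b' : bal (nseq n' false ++ nseq b' true) = b'%:Z - n'%:Z.
  by rewrite /bal !count_cat !count_nseq /= !mul0n !mul1n addn0 add0n.
have rw_bal : b%:Z - a%:Z = d%:Z - c%:Z.
  by rewrite -(bF a b) -(bF c d) -Er -Ew; exact: wcomm_bal rw.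
have cF n' b' : count negb (nseq n' false ++ nseq b' true) = n'.
  by rewrite count_cat !count_nseq /= mul1n mul0n addn0.
have bp n' : bal (nseq n' false) = - n'%:Z by have := bF n' 0%N; rewrite cats0 => ->; lia.
rewrite {}Er {}Ew !cF in rw *; have [ca|ac] := leqP c a.
  exists (nseq a false), (nseq b true); split; first by left.
  have Ea : a = (c + (a - c))%N by lia.
  have Eb : b = (d + (a - c))%N by lia.
  by move: rw; rewrite {1}Ea {1}Eb => /valley/wcomm_same; rewrite bp; lia.
exists (nseq c false), (nseq d true); split; first by right.
have Ec : c = (a + (c - a))%N by lia.
have Ed : d = (b + (c - a))%N by lia.
by move/wcomm_tr: rw; rewrite {1}Ec {1}Ed => /valley/wcomm_same; rewrite bp; lia.
Qed.

(** The exponent is computed by [wcomm_exponent] both for the given pair and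
    after exchanging the two minors, which changes its sign and turns the paths
    upside down. *)
Theorem wcomm_height k m e r w : wcomm k m e r w ->
  exists p p1 p' p1', [/\ r = p ++ p1 \/ w = p ++ p1, r = p' ++ p1' \/ w = p' ++ p1' &
    (bal p' - bal p) *+ 2 = (size r + size w)%N%:Z].
Proof.
move=> rw; have [p [p1 [pp E]]] := wcomm_exponent rw.
have [p' [p1' [pp' E']]] := wcomm_exponent (wcomm_swap rw).
have nK u v1 v2 : map negb u = v1 ++ v2 -> u = map negb v1 ++ map negb v2.
  by move=> uv; rewrite -map_cat -uv mapK //; exact: negbK.
exists p, p1, (map negb p'), (map negb p1'); split=> //.
  by case: pp' => /nK; [left|right].
have cN u : count negb (map negb u) = count id u.
  by rewrite count_map; apply: eq_count => x /=; rewrite negbK.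
have cI u : count id (map negb u) = count negb u by rewrite count_map.
have sz u : size u = (count id u + count negb u)%N by rewrite -(count_predC id).
by move: E E'; rewrite /bal !cN cI (sz r) (sz w); lia.
Qed.
End Exponent.

(** * Quasi-commutation from the entries *)

Definition states k (A C : {set 'I_k}) : seq state := [seq (i \in A, i \in C) | i <- enum 'I_k].

Lemma size_states k (A C : {set 'I_k}) : size (states A C) = k.
Proof. by rewrite size_map size_enum_ord. Qed.

Lemma nth_states k (A C : {set 'I_k}) (i : 'I_k) x0 :
  nth x0 (states A C) i = (i \in A, i \in C).
Proof. by rewrite (nth_map i) ?size_enum_ord // nth_ord_enum. Qed.

Lemma lset1_states k (A C : {set 'I_k}) : lset1 k (states A C) = A.
Proof.
apply/setP=> i; rewrite inE (nth_map (false, false)) ?size_states //.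
by rewrite nth_states.
Qed.

Lemma lset2_states k (A C : {set 'I_k}) : lset2 k (states A C) = C.
Proof.
apply/setP=> i; rewrite inE (nth_map (false, false)) ?size_states //.
by rewrite nth_states.
Qed.

Lemma count_states k (A C : {set 'I_k}) (x : pred state) :
  count x (states A C) = #|[set i | x (i \in A, i \in C)]|.
Proof.
rewrite count_map cardE size_filter -enumT; apply: eq_count => i /=.
by rewrite inE.
Qed.

Lemma count_states1 k (A C : {set 'I_k}) : count id [seq x.1 | x <- states A C] = #|A|.
Proof.
rewrite -(card_lset (k := k)) -/(lset1 k _) ?lset1_states //.
by rewrite size_map size_states.
Qed.

Lemma count_states2 k (A C : {set 'I_k}) : count id [seq x.2 | x <- states A C] = #|C|.
Proof.
rewrite -(card_lset (k := k)) -/(lset2 k _) ?lset2_states //.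
by rewrite size_map size_states.
Qed.

Lemma letters_nested k (A C : {set 'I_k}) : A \subset C ->
  letters (states A C) = nseq (#|C| - #|A|) false.
Proof.
move=> AC; have al : all (pred1 false) (letters (states A C)).
  rewrite all_map; apply/allP => x; rewrite mem_filter => /andP[xn /mapP[i _ xE]].
  move: xn; rewrite {}xE /=; case: (boolP (i \in A)) => // /(subsetP AC) ->.
  by [].
rewrite (all_pred1P _ _ al); congr nseq; rewrite size_map size_filter count_states.
rewrite -[in RHS](setIidPr AC) -cardsD; apply: eq_card => i; rewrite !inE /=.
by case: (boolP (i \in A)) => [/(subsetP AC) ->|_]; rewrite ?andbT //; case: (_ \in C).
Qed.

Lemma sum_mem_im l n (r : 'I_l -> 'I_n) i : incr r ->
  \sum_a (r a == i)%:R = (i \in r @: [set: 'I_l])%:R :> int.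
Proof.
move=> ri; case: imsetP => [[a _ ->]|ni].
  rewrite (bigD1 a) //= eqxx big1 ?addr0 // => b ba.
  by rewrite (inj_eq (incr_inj ri)) (negbTE ba).
by apply: big1 => a _; case: eqP => // e; case: ni; exists a.
Qed.

Definition below k (i : 'I_k) (C : {set 'I_k}) := forall c, c \in C -> (i < c)%N.
Definition above k (i : 'I_k) (C : {set 'I_k}) := forall c, c \in C -> (c < i)%N.

(** Contribution of an index to the exponent between an entry and a minor; it is
    the same function for rows and columns, as quantum matrices are symmetric. *)
Definition side k (i : 'I_k) (C : {set 'I_k}) : int :=
  if i \in C then 0 else if [forall c in C, (i < c)%N] then 1 else -1.

Lemma side_below k (i : 'I_k) (C : {set 'I_k}) : (i \in C) \/ below i C ->
  side i C = 1 - (i \in C)%:R.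
Proof.
rewrite /side; case: ifP => [_ _|_ [//|iC]]; first by rewrite subrr.
by rewrite (introT forall_inP) ?subr0 // => c /iC.
Qed.

Lemma side_above k (i : 'I_k) (C : {set 'I_k}) : C != set0 -> (i \in C) \/ above i C ->
  side i C = (i \in C)%:R - 1.
Proof.
case/set0Pn=> c cC; rewrite /side; case: ifP => [_ _|_ [//|iC]]; first by rewrite subrr.
rewrite ifN ?sub0r //; apply/forall_inP => /(_ _ cC).
by move: (iC _ cC); lia.
Qed.

(** The common rows are put between a first block of [true]'s and the
    [false]'s: then a row of the first minor is in the second one, or above all
    its rows, or below all its rows. *)
Definition blocks z n y x l : seq state :=
  nseq z (true, false) ++ nseq n (true, true) ++ nseq y (false, true) ++
  nseq x (true, false) ++ nseq l (false, false).

Lemma letters_blocks z n y x l :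
  letters (blocks z n y x l) = nseq z true ++ nseq y false ++ nseq x true.
Proof.
have ln p b : letters (nseq p (b, ~~ b)) = nseq p b.
  by rewrite -[RHS]letters_letter map_nseq.
rewrite /blocks !letters_cat !letters_nseq cats0.
by rewrite (ln z true) (ln y false) (ln x true).
Qed.

Lemma in_blocks k z n y x l (i : 'I_k) :
  ((i \in lset1 k (blocks z n y x l)) =
     [|| i < z, z <= i < z + n | z + n + y <= i < z + n + y + x])%N /\
  ((i \in lset2 k (blocks z n y x l)) = (z <= i < z + n + y))%N.
Proof.
rewrite !inE /blocks !map_cat !map_nseq !nth_cat !size_nseq !nth_nseq /=.
by split; repeat (case: ifP => //=); lia.
Qed.

Section Entries.
Variables (F : fieldType) (q : F).
Hypothesis q0 : q != 0.

(** Moving the rows does not change the exponent if it preserves the word and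
    the number of common rows. *)
Lemma qcomm_states k m e (A C A' C' : {set 'I_k}) (B D : {set 'I_m}) :
  letters (states A C) = letters (states A' C') -> #|A :&: C| = #|A' :&: C'| ->
  qcomm q e (qm q A' B) (qm q C' D) -> qcomm q e (qm q A B) (qm q C D).
Proof.
move=> ll cc.
have cT (U V : {set 'I_k}) : count_mem (true, true) (states U V) = #|U :&: V|.
  by rewrite count_states; apply: eq_card => i; rewrite !inE /eq_op /= !eqb_id.
have := leqv_letters q0 m (size_states A C) (size_states A' C') ll.
rewrite !cT => /(_ cc e (states B D)); rewrite /lcomm !lset1_states !lset2_states.
by case.
Qed.

(** In this position [x_ij] commutes up to a power of [q] with every generator
    of the minor: the generators of row [i] contribute [-1], those of column [j]
    contribute 1, and the other ones 0. *)
Lemma corner_top k m (i : 'I_k) (j : 'I_m) (C : {set 'I_k}) (D : {set 'I_m}) :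
  #|C| = #|D| -> (forall c, c \in C -> (i <= c)%N) -> (forall d, d \in D -> (d <= j)%N) ->
  qcomm q ((j \in D)%:R - (i \in C)%:R) (qmat_x q i j) (qm q C D).
Proof.
case/incr_enum2=> l [r [c [ri ci -> ->]]] iC jD.
rewrite -opprB; apply: qcomm_sym => //; rewrite qm_incr //.
rewrite -!sum_mem_im // -sumrN; apply: qdet_qcomm => // a b.
rewrite /qcomm.
have := iC _ (imset_f r (in_setT a)); rewrite leq_eqVlt val_eqE => ra.
have := jD _ (imset_f c (in_setT b)); rewrite leq_eqVlt val_eqE => cb.
have [ra' cb'] : (r a != i -> (i < r a)%N) /\ (c b != j -> (c b < j)%N).
  by split=> [ne|ne]; [move: ra; rewrite eq_sym (negbTE ne)|move: cb; rewrite (negbTE ne)].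
have [Er|/ra' lt_r] := eqVneq (r a) i; have [Ec|/cb' lt_c] := eqVneq (c b) j.
- by rewrite Er Ec subrr expr0z scale1r.
- by rewrite Er subr0 expr1z (qmat_x_row q _ lt_c).
- rewrite Ec (qmat_x_col q _ lt_r) sub0r exprN1 scalerA mulVf //.
  by rewrite scale1r.
- by rewrite (qmat_x_comm q lt_r lt_c) subr0 expr0z scale1r.
Qed.

Lemma corner_bottom k m (i : 'I_k) (j : 'I_m) (C : {set 'I_k}) (D : {set 'I_m}) :
  #|C| = #|D| -> (forall c, c \in C -> (c <= i)%N) -> (forall d, d \in D -> (j <= d)%N) ->
  qcomm q ((i \in C)%:R - (j \in D)%:R) (qmat_x q i j) (qm q C D).
Proof.
case/incr_enum2=> l [r [c [ri ci -> ->]]] iC jD.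
rewrite -opprB; apply: qcomm_sym => //; rewrite qm_incr // addrC.
rewrite -!sum_mem_im // -sumrN; apply: qdet_qcomm => // a b.
rewrite /qcomm.
have := iC _ (imset_f r (in_setT a)); rewrite leq_eqVlt val_eqE => ra.
have := jD _ (imset_f c (in_setT b)); rewrite leq_eqVlt val_eqE => cb.
have [ra' cb'] : (r a != i -> (r a < i)%N) /\ (c b != j -> (j < c b)%N).
  by split=> [ne|ne]; [move: ra; rewrite (negbTE ne)|move: cb; rewrite eq_sym (negbTE ne)].
have [Er|/ra' lt_r] := eqVneq (r a) i; have [Ec|/cb' lt_c] := eqVneq (c b) j.
- by rewrite Er Ec addNr expr0z scale1r.
- by rewrite Er addr0 exprN1 (qmat_x_row q _ lt_c) scalerA mulVf // scale1r.
- by rewrite Ec (qmat_x_col q _ lt_r) oppr0 add0r expr1z.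
- by rewrite (qmat_x_comm q lt_r lt_c) oppr0 addr0 expr0z scale1r.
Qed.

(** A common row [i] can be placed anywhere relative to the other elements of
    [C], as the word of [([set i], C)] consists of [false]'s only. *)
Lemma qcomm_common k m e (i i' : 'I_k) (C : {set 'I_k}) (B D : {set 'I_m}) : i \in C ->
  qcomm q e (qm q [set i'] B) (qm q (tperm i i' @: C) D) ->
  qcomm q e (qm q [set i] B) (qm q C D).
Proof.
move=> iC; have i'C : i' \in tperm i i' @: C by apply/imsetP; exists i; rewrite ?tpermL.
apply: qcomm_states; last by rewrite !(setIidPl _) ?sub1set // !cards1.
rewrite !letters_nested ?sub1set // card_imset ?cards1 //; exact: perm_inj.
Qed.

Lemma to_top k m (i : 'I_k) (C : {set 'I_k}) : (i \in C) \/ below i C ->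
  exists i' (C' : {set 'I_k}), [/\ #|C'| = #|C|, (i' \in C') = (i \in C),
    forall c, c \in C' -> (i' <= c)%N &
    forall e (B D : {set 'I_m}), qcomm q e (qm q [set i'] B) (qm q C' D) ->
                qcomm q e (qm q [set i] B) (qm q C D)].
Proof.
case=> [iC|iC]; last by exists i, C; split=> // c /iC/ltnW.
have k0 : (0 < k)%N by exact: leq_ltn_trans (ltn_ord i).
exists (Ordinal k0), (tperm i (Ordinal k0) @: C); split=> //.
- by rewrite card_imset //; exact: perm_inj.
- by rewrite iC; apply/imsetP; exists i; rewrite ?tpermL.
- by move=> e B D; exact: qcomm_common.
Qed.

Lemma to_bottom k m (i : 'I_k) (C : {set 'I_k}) : (i \in C) \/ above i C ->
  exists i' (C' : {set 'I_k}), [/\ #|C'| = #|C|, (i' \in C') = (i \in C),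
    forall c, c \in C' -> (c <= i')%N &
    forall e (B D : {set 'I_m}), qcomm q e (qm q [set i'] B) (qm q C' D) ->
                qcomm q e (qm q [set i] B) (qm q C D)].
Proof.
case=> [iC|iC]; last by exists i, C; split=> // c /iC/ltnW.
have k0 : (k.-1 < k)%N by move: (ltn_ord i); lia.
exists (Ordinal k0), (tperm i (Ordinal k0) @: C); split=> //.
- by rewrite card_imset //; exact: perm_inj.
- by rewrite iC; apply/imsetP; exists i; rewrite ?tpermL.
- by move=> c _ /=; move: (ltn_ord c); lia.
- by move=> e B D; exact: qcomm_common.
Qed.

(** The row and the column are moved to a corner independently of each other. *)
Lemma qcomm_entry k m (i : 'I_k) (j : 'I_m) (C : {set 'I_k}) (D : {set 'I_m}) :
  #|C| = #|D| -> C != set0 ->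
  ((i \in C) \/ below i C) /\ ((j \in D) \/ above j D) \/
  ((i \in C) \/ above i C) /\ ((j \in D) \/ below j D) ->
  qcomm q (side i C + side j D) (qmat_x q i j) (qm q C D).
Proof.
move=> CD C0 ij; have D0 : D != set0 by rewrite -card_gt0 -CD card_gt0.
rewrite -qm1; case: ij => -[iC jD].
  rewrite (side_below iC) (side_above D0 jD).
  have [i' [C' [cC <- i'C tr]]] := to_top m iC; apply: tr; apply: qcomm_tr.
  have [j' [D' [cD <- j'D tr]]] := to_bottom k jD; apply: tr; apply: qcomm_tr.
  rewrite qm1 [_ + _](_ : _ = (j' \in D')%:R - (i' \in C')%:R); last by ring.
  by apply: corner_top; rewrite ?cC ?cD.
rewrite (side_above C0 iC) (side_below jD).
have [i' [C' [cC <- i'C tr]]] := to_bottom m iC; apply: tr; apply: qcomm_tr.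
have [j' [D' [cD <- j'D tr]]] := to_top k jD; apply: tr; apply: qcomm_tr.
rewrite qm1 [_ + _](_ : _ = (i' \in C')%:R - (j' \in D')%:R); last by ring.
by apply: corner_bottom; rewrite ?cC ?cD.
Qed.

Lemma qcomm_entries k m (A C : {set 'I_k}) (B D : {set 'I_m}) :
  #|A| = #|B| -> #|C| = #|D| -> C != set0 ->
  (forall i j, i \in A -> j \in B ->
    ((i \in C) \/ below i C) /\ ((j \in D) \/ above j D) \/
    ((i \in C) \/ above i C) /\ ((j \in D) \/ below j D)) ->
  exists e, qcomm q e (qm q A B) (qm q C D).
Proof.
move=> /incr_enum2[l [r [c [ri ci -> ->]]]] CD C0 H.
exists (\sum_a side (r a) C + \sum_b side (c b) D); rewrite qm_incr //.
by apply: qdet_qcomm => // a b; apply: qcomm_entry => //; apply: H; rewrite imset_f.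
Qed.

Lemma to_blocks k m (A C : {set 'I_k}) z y x :
  letters (states A C) = nseq z true ++ nseq y false ++ nseq x true ->
  exists n l, let s := blocks z n y x l in
    [/\ #|lset1 k s| = #|A|, #|lset2 k s| = #|C| & leqv q k m (states A C) s].
Proof.
move=> lr; pose n := count_mem (true, true) (states A C).
pose l := count_mem (false, false) (states A C); exists n, l => s.
have ls : letters s = letters (states A C) by rewrite lr letters_blocks.
have nz p b : count_mem (true, true) (nseq p (b, ~~ b)) = 0%N.
  by rewrite count_nseq; case: b.
have ns : count_mem (true, true) s = n.
  rewrite /s /blocks !count_cat (nz z true) (nz y false) (nz x true) !count_nseq /=.
  by rewrite mul1n mul0n !addn0.
have sk : size s = k.
  rewrite -[RHS](size_states A C) (size_count (states A C)) lr !size_cat !size_nseq -/n -/l.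
  by rewrite !addnA; lia.
have sz (g : state -> bool) : size (map g (states A C)) = k.
  by rewrite size_map size_states.
split; last first.
- by apply: leqv_letters; rewrite ?size_states ?ls // ns.
- rewrite -[in RHS](lset2_states A C) !card_lset ?sz // ?size_map //.
  by rewrite (count2 s) (count2 (states A C)) ls ns.
- rewrite -[in RHS](lset1_states A C) !card_lset ?sz // ?size_map //.
  by rewrite (count1 s) (count1 (states A C)) ls ns.
Qed.

(** The last hypothesis excludes an entry above and to the left of the second
    minor. *)
Lemma qcomm_words k m (A C : {set 'I_k}) (B D : {set 'I_m}) z y x v u :
  #|A| = #|B| -> #|C| = #|D| -> C != set0 ->
  letters (states A C) = nseq z true ++ nseq y false ++ nseq x true ->
  letters (states B D) = nseq v true ++ nseq u false ->
  z = 0%N \/ v = 0%N -> exists e, qcomm q e (qm q A B) (qm q C D).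
Proof.
move=> AB CD C0 lr lw zv; have [n [l [cA cC st]]] := to_blocks m lr.
have [n' [l' [cB cD st']]] := @to_blocks m k B D v u 0 (etrans lw (congr1 _ (esym (cats0 _)))).
suff [e E] : exists e, lcomm q k m e (blocks z n y x l) (blocks v n' u 0 l').
  exists e; rewrite -(lset1_states A C) -{2}(lset2_states A C).
  rewrite -(lset1_states B D) -{2}(lset2_states B D).
  by apply/st/lcomm_tr/st'/lcomm_tr.
apply: qcomm_entries; rewrite ?cA ?cB ?cC ?cD //; first by rewrite -card_gt0 cC card_gt0.
have iC i := (in_blocks (k := k) z n y x l i).2.
have jD j := (in_blocks (k := m) v n' u 0 l' j).2.
move=> i j; rewrite !iC !jD (in_blocks z n y x l i).1 (in_blocks v n' u 0 l' j).1.
set iA := [|| _, _ | _]; set jB := [|| _, _ | _] => Ai Bj.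
have jl : (v <= j < v + n' + u)%N \/ below j (lset2 m (blocks v n' u 0 l')).
  case: (ltnP j v) => jv; first by right=> c; rewrite jD; lia.
  by left; move: Bj; rewrite /jB; lia.
case: zv => [z0|v0].
  right; split=> //; case: (ltnP i (z + n)) => iz; first by left; move: Ai; rewrite /iA; lia.
  by right=> c; rewrite iC; move: Ai; rewrite /iA; lia.
have jD' : (v <= j < v + n' + u)%N by move: Bj; rewrite /jB; lia.
case: (ltnP i z) => iz.
  by left; split; [right=> c; rewrite iC; lia|left].
right; split; last by left.
case: (ltnP i (z + n)) => iz'; first by left; lia.
by right=> c; rewrite iC; move: Ai; rewrite /iA; lia.
Qed.
End Entries.

(** * Weak separation in terms of words *)

Lemma nth_fblocks x y z i :
  nth false (nseq x false ++ nseq y true ++ nseq z false) i = (x <= i < x + y)%N.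
Proof.
rewrite !nth_cat !size_nseq !nth_nseq.
by repeat (case: ifP => //=); lia.
Qed.

Lemma fblocksP l : (exists x y z, l = nseq x false ++ nseq y true ++ nseq z false) <->
  (forall u v, l = u ++ false :: v -> true \in u -> true \in v -> False).
Proof.
split=> [[x [y [z ->]]] u v E|].
  move=> /(nthP false)[a au ua] /(nthP false)[b bv vb].
  have nthE i := nth_fblocks x y z i; rewrite E in nthE.
  have := nthE a; have := nthE (size u); have := nthE ((size u).+1 + b)%N.
  rewrite !nth_cat au ltnn subnn ua /= ifN; last by rewrite -leqNgt; lia.
  have -> : ((size u).+1 + b - size u = b.+1)%N by lia.
  rewrite /= vb => /esym h1 /esym/negbT h2 /esym h3.
  have between (n : nat) : (a < n)%N -> (x <= n.+1 + b < x + y)%N ->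
    ~~ (x <= n < x + y)%N -> (x <= a < x + y)%N -> False by lia.
  exact: (between (size u)).
elim: l => [_|b l IHl H]; first by exists 0%N, 0%N, 0%N.
have [u v E Tu Tv|x [y [z E]]] := IHl.
  by apply: (H (b :: u) v); rewrite ?E // inE Tu orbT.
case: b H => H; last by exists x.+1, y, z; rewrite E.
case: y E => [|y] E; first by exists 0%N, 1%N, (x + z)%N; rewrite E nseqD.
case: x E => [|x] E; first by exists 0%N, y.+2, z; rewrite E.
exfalso; apply: (H [:: true] (nseq x false ++ nseq y.+1 true ++ nseq z false)).
- by rewrite E.
- exact: mem_head.
- by rewrite !mem_cat mem_head orbT.
Qed.

Lemma letters_states n (I J : {set 'I_n}) :
  letters (states I J) = [seq i \in I | i <- enum 'I_n & (i \in I) != (i \in J)].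
Proof. by rewrite /letters /states filter_map -map_comp. Qed.

(** The two parts of [J :\: I] are the elements smaller than all of [I :\: J] and
    the other ones; both conditions say that no element of [J :\: I] lies between
    two elements of [I :\: J]. *)
Lemma surroundsP n (I J : {set 'I_n}) : surrounds I J <->
  exists x y z, letters (states I J) = nseq x false ++ nseq y true ++ nseq z false.
Proof.
set L := [seq i <- enum 'I_n | (i \in I) != (i \in J)].
have sL : sorted ltn (map val L).
  rewrite sorted_map; apply: sorted_filter; first by move=> a b c; exact: ltn_trans.
  by rewrite -sorted_map val_enum_ord iota_ltn_sorted.
have Lsplit L1 i L2 : L = L1 ++ i :: L2 ->
    (forall j, j \in L1 -> (j < i)%N) /\ (forall j, j \in L2 -> (i < j)%N).
  move=> E; move: sL; rewrite E map_cat (sorted_pairwise ltn_trans) pairwise_cat /=.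
  case/and4P=> /allrelP r1 _ /allP r2 _; split=> j jL; last by apply: r2; exact: map_f.
  by apply: r1; [exact: map_f|exact: mem_head].
have inL i : (i \in L) = ((i \in I) != (i \in J)) by rewrite mem_filter mem_enum andbT.
suff mid : surrounds I J <-> forall a b c, a \in I :\: J -> b \in J :\: I -> c \in I :\: J ->
    (a < b)%N -> (b < c)%N -> False.
  apply: (iff_trans mid); apply: iff_sym; apply: (iff_trans (fblocksP _)).
  rewrite letters_states -/L; split=> [H a b c aI bJ cI ab bc|H u v E Tu Tv].
    have bL : b \in L by move: bJ; rewrite inL !inE => /andP[/negbTE -> ->].
    have [aL cL] : a \in L /\ c \in L.
      by move: aI cI; rewrite !inL !inE => /andP[/negbTE -> ->] /andP[/negbTE -> ->].
    case: (path.splitPr bL) Lsplit aL cL H => L1 L2 Ls; have [l1 l2] := Ls _ _ _ erefl.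
    have mT i (s : seq 'I_n) : i \in I :\: J -> i \in s -> true \in [seq i \in I | i <- s].
      by rewrite inE => /andP[_ iI] si; apply/mapP; exists i; rewrite ?iI.
    have bI : (b \in I) = false by move: bJ; rewrite !inE => /andP[/negbTE].
    rewrite !mem_cat !inE => aL cL H.
    apply: (H [seq i \in I | i <- L1] [seq i \in I | i <- L2]).
    - by rewrite map_cat /= bI.
    - apply: (mT a) => //; case/or3P: aL => // [/eqP ab'|/l2]; last by lia.
      by move: ab; rewrite ab' ltnn.
    - apply: (mT c) => //; case/or3P: cL => // [/l1|/eqP bc']; first by lia.
      by move: bc; rewrite bc' ltnn.
  have EL : L = take (size u) L ++ drop (size u) L by rewrite cat_take_drop.
  have Eu : u = [seq i \in I | i <- take (size u) L] by rewrite map_take E take_size_cat.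
  have Ev : false :: v = [seq i \in I | i <- drop (size u) L].
    by rewrite map_drop E drop_size_cat.
  case: (drop (size u) L) EL Ev => [//|b L2] EL [bI Ev].
  have [l1 l2] := Lsplit _ _ _ EL.
  have LI i : i \in L -> i \in I -> i \in I :\: J.
    by rewrite inL inE => iL iI; move: iL; rewrite iI; case: (i \in J).
  move: Tu Tv; rewrite Eu Ev => /mapP[a aL /esym aI] /mapP[c cL /esym cI].
  apply: (H a b c); rewrite ?l1 ?l2 //.
  - by apply: LI; rewrite // EL mem_cat aL.
  - have : b \in L by rewrite EL mem_cat mem_head orbT.
    by rewrite inL inE -bI; case: (b \in J).
  - by apply: LI; rewrite // EL mem_cat inE cL !orbT.
split=> [[J1 [J2 [E dJ J1I J2I]]] a b c aI bJ cI ab bc|H].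
  move: bJ; rewrite E inE => /orP[bJ|bJ].
    by have := J1I _ _ bJ aI; lia.
  by have := J2I _ _ cI bJ; lia.
exists [set j in J :\: I | [forall c in I :\: J, (j < c)%N]],
       [set j in J :\: I | ~~ [forall c in I :\: J, (j < c)%N]]; split.
- by apply/setP=> j; rewrite !inE -andb_orr orbN andbT.
- by apply/pred0P => j; rewrite /= !inE; case: [forall _ in _, _]; rewrite !andbF.
- by move=> j c; rewrite inE => /andP[_ /forall_inP]; apply.
move=> c j cI; rewrite inE => /andP[jJ]; rewrite negb_forall_in => /exists_inP[a aI].
rewrite -leqNgt leq_eqVlt => /orP[/eqP/val_inj aj|aj].
  by move: aI jJ; rewrite aj !inE; case: (j \in I); rewrite ?andbF.
rewrite ltnNge leq_eqVlt; apply/negP => /orP[/eqP/val_inj cj|jc].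
  by move: cI jJ; rewrite cj !inE; case: (c \in I); rewrite ?andbF.
exact: (H a j c).
Qed.

Lemma letters_sym n (I J : {set 'I_n}) :
  letters (states J I) = map negb (letters (states I J)).
Proof.
rewrite !letters_states -map_comp.
rewrite (eq_filter (a2 := fun i => (i \in I) != (i \in J))); last by move=> i; rewrite eq_sym.
apply/eq_in_map => i; rewrite mem_filter => /andP[+ _] /=.
by case: (i \in I) (i \in J) => [] [].
Qed.

Lemma states_minor_set k m (A C : {set 'I_k}) (B D : {set 'I_m}) :
  states (minor_set A B) (minor_set C D) =
  rev [seq (~~ x.1, ~~ x.2) | x <- states A C] ++ states B D.
Proof.
have rowE (i : 'I_k) (U : {set 'I_k}) (V : {set 'I_m}) :
    (lshift m i \in minor_set U V) = (rev_ord i \notin U).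
  rewrite !inE (negbTE (_ : lshift m i \notin _)) /=; last first.
    by apply/imsetP => -[j _ /eqP]; rewrite eq_lrshift.
  rewrite (mem_imset _ _ (@lshift_inj _ _)) inE; congr (~~ _).
  by rewrite -[i in LHS]rev_ordK (mem_imset _ _ rev_ord_inj).
have colE (j : 'I_m) (U : {set 'I_k}) (V : {set 'I_m}) :
    (rshift k j \in minor_set U V) = (j \in V).
  rewrite !inE (mem_imset _ _ (@rshift_inj _ _)) orbC (negbTE (_ : rshift k j \notin _)) //.
  by apply/imsetP => -[i _ /eqP]; rewrite eq_rlshift.
apply: (@eq_from_nth _ (false, false)).
  by rewrite size_cat size_rev size_map !size_states.
rewrite size_states => i' lt_i; pose i := Ordinal lt_i; rewrite -[i']/(val i).
rewrite nth_states nth_cat size_rev size_map size_states.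
case: (split_ordP i) => j ->.
  have sz : size [seq (~~ x.1, ~~ x.2) | x <- states A C] = k.
    by rewrite size_map size_states.
  rewrite /= !rowE nth_rev ?sz // (nth_map (false, false)) ?size_states; last first.
    exact: (ltn_ord (rev_ord j)).
  by rewrite -[(k - j.+1)%N]/(val (rev_ord j)) nth_states.
by rewrite /= addKn nth_states !colE.
Qed.

Lemma letters_minor_set k m (A C : {set 'I_k}) (B D : {set 'I_m}) :
  letters (states (minor_set A B) (minor_set C D)) =
  rev (map negb (letters (states A C))) ++ letters (states B D).
Proof.
rewrite states_minor_set letters_cat; congr (_ ++ _).
rewrite /letters filter_rev map_rev; congr rev.
by elim: (states A C) => [|[[] []] s] //= ->.
Qed.

Lemma card_minor_set k m (A : {set 'I_k}) (B : {set 'I_m}) : #|A| = #|B| ->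
  #|minor_set A B| = k.
Proof.
move=> AB; rewrite cardsU (_ : _ :&: _ = set0) ?cards0 ?subn0; last first.
  apply/setP=> i; rewrite !inE; apply/negP => /andP[/imsetP[j _ ->] /imsetP[j' _ /eqP]].
  by rewrite eq_rlshift.
rewrite (card_imset _ (@rshift_inj _ _)) (card_imset _ (@lshift_inj _ _)).
have := cardsC [set rev_ord a | a in A].
by rewrite card_ord (card_imset _ rev_ord_inj) AB.
Qed.

(** * Quasi-commutation and weak separation *)

Lemma bal_negb l : bal (map negb l) = - bal l.
Proof.
rewrite /bal !count_map opprB; congr (_ - _).
by congr Posz; apply: eq_count => x /=; rewrite negbK.
Qed.

Lemma bal_rev_negb l : bal (rev (map negb l)) = - bal l.
Proof. by rewrite -bal_negb /bal !count_rev. Qed.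

Lemma all_false l : count id l = 0%N -> l = nseq (size l) false.
Proof.
move=> l0; apply/all_pred1P/allP => x xl; apply/eqP/negbTE/negP => xT.
by move: l0; apply/eqP; rewrite -lt0n -has_count; apply/hasP; exists x.
Qed.

(** A factor of maximal height takes all the letters [true], and is made of
    them only. *)
Lemma fblocks_height l : bal l = 0 ->
  (exists u s v, l = u ++ s ++ v /\ bal s *+ 2 = (size l)%:Z) ->
  exists x y z, l = nseq x false ++ nseq y true ++ nseq z false.
Proof.
move=> l0 [u [s [v [E b]]]]; exists (size u), (size s), (size v).
have sz w : size w = (count id w + count negb w)%N by rewrite -(count_predC id).
move: l0 b; rewrite E (sz (u ++ _)) /bal !count_cat => l0 b.
rewrite -(all_false (l := u)); last by lia.
rewrite -(all_false (l := v)); last by lia.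
congr (_ ++ (_ ++ _)); have s0 : count negb s = 0%N by lia.
apply/all_pred1P/allP => x xs; apply/eqP; move: s0; case: x xs => // xs s0.
by move/eqP: s0; rewrite eqn0Ngt -has_count => /negP[]; apply/hasP; exists false.
Qed.

Lemma prefix_split (l p p1 p' p1' : seq bool) : l = p ++ p1 -> l = p' ++ p1' ->
  (exists s, p' = p ++ s) \/ (exists s, p = p' ++ s).
Proof.
elim: p l p' => [|x p IHp] l p'; first by move=> _ _; left; exists p'.
case: p' => [|y p'] ->; first by move=> _; right; exists (x :: p).
by case=> <- /(IHp _ _ erefl) [[s ->]|[s ->]]; [left|right]; exists s.
Qed.

(** The paths drawn by [r] and [w] from a common origin are the two halves of
    the path drawn by [rev (map negb r) ++ w]; the part of it between two
    points is a factor of the word. *)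
Lemma height_factor r w p p1 p' p1' :
  r = p ++ p1 \/ w = p ++ p1 -> r = p' ++ p1' \/ w = p' ++ p1' ->
  exists u s v, rev (map negb r) ++ w = u ++ s ++ v /\
    (bal s = bal p' - bal p \/ bal s = bal p - bal p').
Proof.
pose R l := rev (map negb l); rewrite -/(R r).
have Rcat a b : R (a ++ b) = R b ++ R a by rewrite /R map_cat rev_cat.
have bR a : bal (R a) = - bal a by exact: bal_rev_negb.
case=> [rp|wp] [rp'|wp'].
- have [[s E]|[s E]] := prefix_split rp rp'.
    exists (R p1'), (R s), (R p ++ w); rewrite rp' E !Rcat !catA; split=> //.
    by right; rewrite bR bal_cat; ring.
  exists (R p1), (R s), (R p' ++ w); rewrite rp E !Rcat !catA; split=> //.
  by left; rewrite bR bal_cat; ring.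
- exists (R p1), (R p ++ p'), p1'; rewrite rp wp' Rcat !catA; split=> //.
  by left; rewrite bal_cat bR addrC.
- exists (R p1'), (R p' ++ p), p1; rewrite rp' wp Rcat !catA; split=> //.
  by right; rewrite bal_cat bR addrC.
have [[s E]|[s E]] := prefix_split wp wp'.
  exists (R r ++ p), s, p1'; rewrite wp' E !catA; split=> //.
  by left; rewrite bal_cat; ring.
exists (R r ++ p'), s, p1; rewrite wp E !catA; split=> //.
by right; rewrite bal_cat; ring.
Qed.

Lemma cat_fblocks u v x y z : u ++ v = nseq x false ++ nseq y true ++ nseq z false ->
  [\/ exists a b, x = (a + b)%N /\ u = nseq a false /\
        v = nseq b false ++ nseq y true ++ nseq z false,
      exists a b, y = (a + b)%N /\ u = nseq x false ++ nseq a true /\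
        v = nseq b true ++ nseq z false |
      exists a b, z = (a + b)%N /\ u = nseq x false ++ nseq y true ++ nseq a false /\
        v = nseq b false].
Proof.
move=> E; have sz : (size u + size v = x + (y + z))%N.
  by rewrite -size_cat E !size_cat !size_nseq.
have cut (u' v' : seq bool) : nseq x false ++ nseq y true ++ nseq z false = u' ++ v' ->
    size u = size u' -> u = u' /\ v = v'.
  by move=> E' su; move/eqP: E; rewrite E' eqseq_cat // => /andP[/eqP-> /eqP->].
have [ux|xu] := leqP (size u) x.
  have Ex : x = (size u + (x - size u))%N by lia.
  constructor 1; exists (size u), (x - size u)%N; split=> //; apply: cut.
    by rewrite {1}Ex nseqD -catA.
  by rewrite size_nseq.
have [uy|yu] := leqP (size u) (x + y).
  have Ey : y = ((size u - x) + (x + y - size u))%N by lia.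
  constructor 2; exists (size u - x)%N, (x + y - size u)%N; split=> //; apply: cut.
    by rewrite {1}Ey nseqD -!catA.
  by rewrite size_cat !size_nseq; lia.
have Ez : z = ((size u - x - y) + size v)%N by lia.
constructor 3; exists (size u - x - y)%N, (size v); split=> //; apply: cut.
  by rewrite {1}Ez nseqD -!catA.
by rewrite !size_cat !size_nseq; lia.
Qed.

Lemma map_negb_nseq n b : map negb (nseq n b) = nseq n (~~ b).
Proof. by elim: n => //= n ->. Qed.

Lemma rev_nseq_eq n (b : bool) : rev (nseq n b) = nseq n b.
Proof. by elim: n => //= n IHn; rewrite rev_cons IHn -cats1 -(nseqD n 1) addn1. Qed.

Section Main.
Variables (F : fieldType) (q : F).
Hypothesis q0 : q != 0.
Variables k m : nat.
Implicit Types (A C : {set 'I_k}) (B D : {set 'I_m}).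

(** The three cases are those of the position, in the word of
    [false]'s, [true]'s and [false]'s, of the cut between rows and columns.  In
    the first one the two minors and the roles of rows and columns are
    exchanged. *)
Lemma surrounds_qcomm A C B D : #|A| = #|B| -> #|C| = #|D| -> A != set0 -> C != set0 ->
  surrounds (minor_set A B) (minor_set C D) -> exists e, qcomm q e (qm q A B) (qm q C D).
Proof.
move=> AB CD A0 C0 /surroundsP[x [y [z]]]; rewrite letters_minor_set.
have B0 : B != set0 by rewrite -card_gt0 -AB card_gt0.
have rE l : rev (map negb (letters (states A C))) = l ->
    letters (states A C) = rev (map negb l).
  by move=> <-; rewrite map_rev revK mapK //; exact: negbK.
case/cat_fblocks=> -[a [b [_ [/rE lr lw]]]].
- have [e] : exists e, qcomm q e (qm q D C) (qm q B A).
    apply: (@qcomm_words _ _ q0 _ _ D B C A b y z 0 a) => //; last by right.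
      by rewrite letters_sym lw !map_cat !map_negb_nseq.
    by rewrite letters_sym lr map_rev mapK ?rev_nseq_eq //; exact: negbK.
  by move=> /qcomm_tr/(qcomm_sym q0); exists (- e).
- apply: (@qcomm_words _ _ q0 _ _ A C B D 0 a x b z) => //; last by left.
  by rewrite lr !map_cat !map_negb_nseq rev_cat !rev_nseq_eq.
- apply: (@qcomm_words _ _ q0 _ _ A C B D a y x 0 b) => //; last by right.
  by rewrite lr !map_cat !map_negb_nseq !rev_cat !rev_nseq_eq -catA.
Qed.

Hypothesis q_inf : forall e : int, q ^ e = 1 -> e = 0.

Theorem qcomm_weakly_separated A C B D :
  #|A| = #|B| -> #|C| = #|D| -> A != set0 -> C != set0 ->
  (exists e, qcomm q e (qm q A B) (qm q C D)) <->
  weakly_separated (minor_set A B) (minor_set C D).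
Proof.
move=> AB CD A0 C0; rewrite /weakly_separated !card_minor_set // leqnn.
split=> [[e E]|[[_ H]|[_ H]]]; last first.
- have [e E] := surrounds_qcomm CD AB C0 A0 H.
  by exists (- e); apply: qcomm_sym.
- exact: surrounds_qcomm H.
have rw : wcomm q k m e (letters (states A C)) (letters (states B D)).
  exists (states A C), (states B D); rewrite !size_states.
  split=> //; last by rewrite /lcomm !lset1_states !lset2_states.
  + by rewrite !count_states1.
  + by rewrite !count_states2.
have [p [p1 [p' [p1' [pp pp' pb]]]]] := wcomm_height q0 q_inf rw.
have [u [s [v [zE zb]]]] := height_factor pp pp'.
rewrite -letters_minor_set in zE.
have sz_z : size (letters (states (minor_set A B) (minor_set C D))) =
    (size (letters (states A C)) + size (letters (states B D)))%N.
  by rewrite letters_minor_set size_cat size_rev size_map.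
have bz : bal (letters (states (minor_set A B) (minor_set C D))) = 0.
  by rewrite letters_minor_set bal_cat bal_rev_negb (wcomm_bal rw) addNr.
case: zb => sb; [left|right]; split=> //; apply/surroundsP/fblocks_height => //.
- by exists u, s, v; rewrite sb sz_z.
- by rewrite letters_sym bal_negb bz oppr0.
- exists (map negb u), (map negb s), (map negb v).
  rewrite letters_sym; split; first by rewrite zE !map_cat.
  by rewrite bal_negb sb opprB size_map sz_z -pb.
Qed.
End Main.

Lemma Cq_q_neq0 (R : realType) : Cq_q R != 0.
Proof. by rewrite tofrac_eq0 polyX_eq0. Qed.

Lemma Cq_q_transcendental (R : realType) (e : int) : Cq_q R ^ e = 1 -> e = 0.
Proof.
have X n : Cq_q R ^+ n = 1 -> n = 0%N.
  rewrite /Cq_q -rmorphXn /= -(rmorph1 (@tofrac _)) => /eqP.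
  rewrite tofrac_eq => /eqP/(congr1 (fun p : {poly _} => size p)).
  by rewrite size_polyXn size_poly1 => -[].
case: e => n; first by move/X ->.
by rewrite NegzE -exprnN => /(congr1 GRing.inv); rewrite invrK invr1 => /X.
Qed.

Local Close Scope quotient_scope.
Local Close Scope ring_scope.

Theorem theorem1 (R : realType) (k m : nat) (hk : 1 <= k) (hkm : k <= m)
    (A C : {set 'I_k}) (B D : {set 'I_m})
    (hA : A != set0) (hB : B != set0) (hC : C != set0) (hD : D != set0)
    (hAB : #|A| = #|B|) (hCD : #|C| = #|D|) :
  quasi_commute (qminor (Cq_q R) hAB) (qminor (Cq_q R) hCD) <->
  weakly_separated (minor_set A B) (minor_set C D).
Proof.
have main := qcomm_weakly_separated (Cq_q_neq0 R) (@Cq_q_transcendental R) hAB hCD hA hC.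
by rewrite /quasi_commute -(qmE (Cq_q R) hAB) -(qmE (Cq_q R) hCD); exact: main.
Qed.
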